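(* Let $W$ be a $\Phi_d$-complex which is also a flag complex, and let $k$ be an odd integer. Let $T:=W^{(1)}$ be the vertex-edge graph ($1$-skeleton) of $W$. Then for each graph $G$, \[ Hom(T,G)\text{ is $k$-connected}\ \Longrightarrow\ \chi(G)\geq k+d+3 . \]
   Context: All graphs and simplicial complexes are finite; graphs are undirected, without loops and multiple edges; $\chi(G)$ is the usual chromatic number. A space is $k$-connected ($k\ge -1$) if it is non-empty and its homotopy groups $\pi_i$ vanish for $0\le i\le k$. For graphs $T,G$, the graph complex $Hom(T,G)\subset\prod_{x\in V(T)}\Delta^{V(G)}$ (where $\Delta^S$ is the simplex with vertex set $S$) is the union of the cells $\prod_{x\in V(T)}\Delta^{\eta(x)}$ over all functions $\eta:V(T)\to 2^{V(G)}\setminus\{\emptyset\}$ such that for every edge $\overline{xy}\in E(T)$ and all $a\in\eta(x)$, $b\in\eta(y)$ one has $\overline{ab}\in E(G)$. A simplicial complex $W$ is a flag complex if a set $\sigma$ of its vertices is a simplex of $W$ whenever every pair of vertices of $\sigma$ spans an edge of $W$. For a pure $d$-dimensional simplicial complex $\Gamma$ and a $d$-simplex $\sigma$ of $\Gamma$, the group of projectivities $\Pi(\Gamma,\sigma)$ is the group of all permutations of the vertices of $\sigma$ of the form $\overrightarrow{\sigma_0\sigma_1}\ast\cdots\ast\overrightarrow{\sigma_{n-1}\sigma_n}$ (apply the first map first), where $\sigma_0=\sigma_n=\sigma$, each $\sigma_i$ is a $d$-simplex of $\Gamma$, consecutive simplices $\sigma_i,\sigma_{i+1}$ share a common $(d-1)$-face,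 and $\overrightarrow{\sigma_i\sigma_{i+1}}:\sigma_i\to\sigma_{i+1}$ is the bijection of vertex sets fixing that common face pointwise. A pure $d$-dimensional simplicial complex $\Gamma$ is a $\Phi_d$-complex if it is equipped with a simplicial involution $\omega:\Gamma\to\Gamma$ (is a $\mathbb{Z}_2$-complex) and has an $\omega$-invariant $d$-simplex $\sigma=\{v_0,\ldots,v_d\}$ such that the restriction $\tau:=\omega|_\sigma$ is a non-trivial element of the group $\Pi(\Gamma,\sigma)$. *)

(* Defs.v *)
From HB Require Import structures.
From mathcomp Require Import all_boot all_order all_algebra.
From mathcomp Require Import all_classical all_reals all_analysis.

Set Implicit Arguments.
Unset Strict Implicit.
Unset Printing Implicit Defensive.

Import Order.TTheory GRing.Theory Num.Theory.
Import numFieldNormedType.Exports.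

Record sgraph := SGraph {
  vertex :> finType;
  edge : rel vertex;
  edge_sym : symmetric edge;
  edge_irr : irreflexive edge
}.

Definition colorable (G : sgraph) (n : nat) : bool :=
  [exists c : {ffun G -> 'I_n}, forall x, forall y, edge x y ==> (c x != c y)].

Lemma colorable_exists (G : sgraph) : exists n, colorable G n.
Proof.
exists #|G|; apply/existsP; exists [ffun x => enum_rank x].
apply/forallP => x; apply/forallP => y; apply/implyP => exy.
rewrite !ffunE (inj_eq enum_rank_inj).
by apply: contraTneq exy => ->; rewrite edge_irr.
Qed.

Definition chi (G : sgraph) : nat := ex_minn (colorable_exists G).

Section Complexes.
Local Open Scope set_scope.

(* The empty set is counted as a simplex (of dimension -1), and every element
   of the carrier is a vertex, so that the dimension of s is #|s| - 1. *)
Record scomplex := SComplex {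
  cvertex :> finType;
  simplices : {set {set cvertex}};
  simplices0 : finset.set0 \in simplices;
  simplices1 : forall v, [set v] \in simplices;
  simplicesS : forall s t : {set cvertex},
    t \subset s -> s \in simplices -> t \in simplices
}.

Definition dsimplices (W : scomplex) (d : nat) : {set {set W}} :=
  [set s in simplices W | #|s| == d.+1].

Definition flag (W : scomplex) : Prop :=
  forall s : {set W},
    {in s &, forall x y, x != y -> [set x; y] \in simplices W} ->
    s \in simplices W.

Definition pure (W : scomplex) (d : nat) : Prop :=
  forall s : {set W},
    maxset (fun t => t \in simplices W) s -> s \in dsimplices W d.

Definition skel_edge (W : scomplex) : rel W :=
  fun x y => (x != y) && ([set x; y] \in simplices W).

Lemma skel_edge_sym (W : scomplex) : symmetric (@skel_edge W).
Proof. by move=> x y; rewrite /skel_edge eq_sym finset.setUC. Qed.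

Lemma skel_edge_irr (W : scomplex) : irreflexive (@skel_edge W).
Proof. by move=> x; rewrite /skel_edge eqxx. Qed.

Definition skeleton1 (W : scomplex) : sgraph :=
  SGraph (@skel_edge_sym W) (@skel_edge_irr W).

Section Projectivities.
Context (W : scomplex) (d : nat).
Implicit Types (s t u : {set W}) (f g : W -> W).

(* Bijections s -> t between simplices are represented by functions W -> W,
   whose values outside s are irrelevant. *)
Definition perspectivity s t f : Prop :=
  exists2 e : {set W}, [/\ #|e| = d, e \subset s & e \subset t] &
    [/\ {in s &, injective f}, f @: s = t & {in e, forall x, f x = x}].

Inductive projectivity s : {set W} -> (W -> W) -> Prop :=
| projectivity_nil : s \in dsimplices W d -> projectivity s s id
| projectivity_step t u f g : projectivity s t f ->
    u \in dsimplices W d -> perspectivity t u g -> projectivity s u (g \o f).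

Definition projectivity_group s f : Prop :=
  exists2 g, projectivity s s g & {in s, f =1 g}.

End Projectivities.

Record Phi_complex (d : nat) (W : scomplex) (omega : W -> W) : Prop := {
  Phi_pure : pure W d;
  Phi_involutive : involutive omega;
  Phi_simplicial : forall s, s \in simplices W -> omega @: s \in simplices W;
  Phi_projectivity : exists sigma : {set W},
    [/\ sigma \in dsimplices W d, omega @: sigma = sigma,
        projectivity_group d sigma omega & ~ {in sigma, omega =1 id}]
}.

End Complexes.

Arguments Phi_complex : clear implicits.

Local Open Scope classical_set_scope.
Local Open Scope ring_scope.

Section HomComplex.
Context (R : realType) (T G : sgraph).

(* The product topology on the coordinates; T and G are finite. *)
Definition hom_space : topologicalType :=
  {ptws T -> ({ptws G -> R} : topologicalType)}.

(* The face of the standard simplex on the vertex set S that is spanned by A,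
   in barycentric coordinates. *)
Definition std_simplex (S : finType) (A : {set S}) : set (S -> R) :=
  [set p | [/\ forall a, 0 <= p a, \sum_a p a = 1
             & forall a, a \notin A -> p a = 0]].

Definition hom_cell (eta : T -> {set G}) : Prop :=
  (forall x, eta x != finset.set0) /\
  (forall x y, edge x y -> {in eta x & eta y, forall a b, edge a b}).

Definition Hom_complex : set hom_space :=
  \bigcup_(eta in hom_cell) [set p : hom_space | forall x, std_simplex (eta x) (p x)].

End HomComplex.

Arguments Hom_complex : clear implicits.

Section Connectivity.
Context (R : realType).

Definition cube (n : nat) : set 'rV[R]_n :=
  [set v : 'rV[R]_n | forall i, 0 <= v ord0 i <= 1].

Definition cube_boundary (n : nat) : set 'rV[R]_n :=
  [set v : 'rV[R]_n | cube v /\ exists i, v ord0 i = 0 \/ v ord0 i = 1].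

Context (X : topologicalType) (A : set X).

Definition based_cube (n : nat) (x0 : X) (f : 'rV[R]_n -> X) : Prop :=
  [/\ {within @cube n, continuous f}, f @` @cube n `<=` A
    & forall v, cube_boundary v -> f v = x0].

Definition based_homotopic (n : nat) (x0 : X) (f g : 'rV[R]_n -> X) : Prop :=
  exists H : R * 'rV[R]_n -> X,
  [/\ {within `[0, 1]%classic `*` @cube n, continuous H},
      forall v, cube v -> H (0, v) = f v,
      forall v, cube v -> H (1, v) = g v
    & forall t : R, 0 <= t <= 1 -> based_cube x0 (fun v => H (t, v))].

(* The homotopy group pi_n(A, x0), that is, the set of homotopy classes
   rel boundary of maps (I^n, dI^n) -> (A, x0), has a single element.
   For n = 0 this says that A is path-connected, as I^0 is a point and its
   boundary is empty. *)
Definition trivial_homotopy_group (n : nat) (x0 : X) : Prop :=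
  forall f g : 'rV[R]_n -> X,
    based_cube x0 f -> based_cube x0 g -> based_homotopic x0 f g.

Definition k_connected (k : int) : Prop :=
  A !=set0 /\
  forall n : nat, n%:Z <= k ->
    forall x0, A x0 -> trivial_homotopy_group n x0.

End Connectivity.

(* Main.v *)
Require Import Defs.
From mathcomp Require Import all_boot all_order all_algebra all_fingroup.
From mathcomp Require Import all_classical all_reals all_analysis.
From mathcomp Require Import ring lra zify.

(* Put n = k + 1, which is even, and suppose that G has a colouring with
   n + d + 1 colours.  As X = Hom(T, G) is (n-1)-connected, there is an
   equivariant map of the n-sphere, with the antipodal action, into X, with the
   action of omega.  Place the colours on the moment curve of R^(n+1).  For
   distinct vertices x, y of a d-simplex of W, a point p of X gives two
   barycentres of colours, p x and p y; the other d - 1 vertices of the simplex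
   use further colours, so that only n + 2 points of the curve matter; they are
   affinely independent, and the difference of the barycentres is nonzero.  The
   n-sphere is thus mapped to R^(n+1) minus 0, with a degree deg(x, y).  Moving
   (x, y) linearly along a perspectivity does not change the degree, hence
   deg(v, omega v) = deg(omega v, v) when omega restricts to a projectivity of a
   simplex that contains v.  On the other hand, the antipodal map of the
   n-sphere has degree -1 since n is even, so that
   deg(omega v, omega (omega v)) = - deg(v, omega v), and the degree is zero.
   But for omega v <> v the map is odd, and its degree is odd.

   The degree is computed on a fine cubical grid from the signs of the
   coordinates.  If p_j is the 0-cochain that is 1 or 0 according to the sign of
   the j-th coordinate, then the cochain d p_0 u ... u d p_(n-1) u p_n
   represents the generator of the cohomology of R^(n+1) minus 0, because
   d p_0 u ... u d p_n vanishes on every small cube: some coordinate has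
   constant sign there. *)

Set Implicit Arguments.
Unset Strict Implicit.
Unset Printing Implicit Defensive.

Import Order.TTheory GRing.Theory Num.Theory.
Import numFieldNormedType.Exports.
Local Open Scope ring_scope.

(** * Degrees on cubical grids *)

(* [v l j] is the value of the 0-cochain p_j at the vertex l of a simplex;
   [theta i] is the cup product of the coboundaries of p_0, ..., p_(i-1), and
   [kappa i] is the cup product of [theta i] and p_i. *)
Definition theta i (v : nat -> nat -> int) : int :=
  \prod_(j < i) (v j.+1 j - v j j).

Definition kappa i (v : nat -> nat -> int) : int := theta i v * v i i.

Lemma eq_theta i v w : (forall l, (l <= i)%N -> v l = w l) -> theta i v = theta i w.
Proof.
by move=> vw; apply: eq_bigr => j _; rewrite !vw // ltnW.
Qed.

Lemma eq_kappa i v w : (forall l, (l <= i)%N -> v l = w l) -> kappa i v = kappa i w.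
Proof. by move=> vw; rewrite /kappa (eq_theta vw) vw. Qed.

(** Leibniz rule: in the cup product [kappa i] only the last factor p_i is not closed. *)
Lemma kappa_coboundary i v :
  \sum_(l < i.+2) (-1) ^+ l * kappa i (v \o bump l) = (-1) ^+ i * theta i.+1 v.
Proof.
elim: i v => [|i IHi] v.
  rewrite !big_ord_recl big_ord0 /kappa /theta !big_ord0 big_ord_recl big_ord0 /=.
  rewrite /bump /= ; ring.
pose w l j := v l.+1 j.+1.
have kS u : kappa i.+1 u = (u 1 0 - u 0 0) * kappa i (fun l j => u l.+1 j.+1).
  rewrite /kappa /theta big_ord_recl /= mulrA; congr (_ * _ * _).
have tS : theta i.+2 v = (v 1 0 - v 0 0) * theta i.+1 w.
  by rewrite /theta big_ord_recl.
rewrite tS mulrCA exprS mulN1r mulNr mulrN -IHi.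
rewrite big_ord_recl big_ord_recl [in RHS]big_ord_recl /= !kS.
have -> : kappa i (fun l j => (v \o bump 0) l.+1 j.+1) = kappa i (w \o bump 0).
  by apply: eq_kappa.
(* Faces 0 and 1 share the factor [kappa i (w \o bump 0)]; their first factors combine to minus
   [v 1 0 - v 0 0]. *)
rewrite mulrDr opprD addrA; congr (_ + _).
  by rewrite /bump /=; ring.
rewrite mulr_sumr -sumrN; apply: eq_bigr => l _.
rewrite kS /bump /= !add1n !exprS.
set a := kappa _ _; set b := kappa _ _.
have -> : a = b.
  by rewrite /a /b; congr kappa; apply/funext => k /=; rewrite ltnS addnS.
ring.
Qed.

(** * Stokes' formula on one triangulated cube *)

Section Kuhn.
Variable X : Type.
Implicit Types (F : (nat -> X) -> int).

(* The permutation s stands for the simplex of the Kuhn triangulation of the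
   cube with vertices g [k |-> s k < l], for l = 0, ..., i. *)
Definition kuhn i F (g : {ffun 'I_i -> bool} -> X) : int :=
  \sum_(s : 'S_i) (-1) ^+ s * F (fun l => g [ffun k => (s k < l)%N]).

Definition insb i (k : 'I_i.+1) b (B : {ffun 'I_i -> bool}) :
    {ffun 'I_i.+1 -> bool} :=
  [ffun j => if unlift k j is Some j' then B j' else b].

(** Permutations are sorted by the position [k] that they send to [j0]; deleting [k] and its value
    inverts [lift_perm]. *)
Lemma sum_lift_perm i (j0 : 'I_i.+1) (h : 'S_i.+1 -> int) :
  \sum_(s : 'S_i.+1) h s = \sum_(k : 'I_i.+1) \sum_(s : 'S_i) h (lift_perm k j0 s).
Proof.
rewrite (partition_big (fun s : 'S_i.+1 => (s^-1)%g j0) xpredT) //=.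
apply: eq_bigr => k _.
pose ulsf k (s : 'S_i.+1) (k1 : 'I_i) := odflt k1 (unlift (s k) (s (lift k k1))).
have ulsfK k' (s : 'S_i.+1) k1 : lift (s k') (ulsf k' s k1) = s (lift k' k1).
  rewrite /ulsf; have:= neq_lift k' k1.
  by rewrite -(inj_eq (@perm_inj _ s)) => /unlift_some[? ? ->].
have inj_ulsf s : injective (ulsf k s).
  apply: can_inj (ulsf (s k) (s^-1)%g) _ => k1.
  by rewrite {1}/ulsf ulsfK !permK liftK.
rewrite (reindex (lift_perm k j0)); last first.
  exists (fun s => perm (inj_ulsf s)) => [s _ | s].
    by apply/permP=> k'; rewrite permE /ulsf lift_perm_id lift_perm_lift liftK.
  rewrite inE => /eqP E; apply/permP=> k'.
  have Ej : s k = j0 by rewrite -E permKV.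
  case: (unliftP k k') => [j'|] ->; rewrite ?lift_perm_id ?Ej //.
  by rewrite lift_perm_lift -Ej permE ulsfK.
apply: eq_bigl => s; apply/eqP; apply: (@perm_inj _ (lift_perm k j0 s)).
by rewrite permKV lift_perm_id.
Qed.

(** The faces opposite to the first and to the last vertex triangulate the facets of the cube where
    a coordinate is 1 and 0; all other faces cancel in pairs. *)
Lemma kuhn_boundary i F g :
  (forall v w, (forall l, (l <= i)%N -> v l = w l) -> F v = F w) ->
  kuhn (fun v => \sum_(l < i.+2) (-1) ^+ l * F (v \o bump l)) g
  = \sum_(k < i.+1) (-1) ^+ k *
      (kuhn F (g \o insb k true) - kuhn F (g \o insb k false)).
Proof.
move=> Fext; rewrite /kuhn.
pose V (s : 'S_i.+1) l := g [ffun k => (s k < l)%N].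
transitivity (\sum_(l < i.+2) (-1) ^+ l * \sum_(s : 'S_i.+1) (-1) ^+ s * F (V s \o bump l)).
  under eq_bigr do rewrite mulr_sumr.
  rewrite exchange_big; apply: eq_bigr => l _; rewrite mulr_sumr.
  by apply: eq_bigr => s _; rewrite mulrCA.
have mid (l : 'I_i) : \sum_(s : 'S_i.+1) (-1) ^+ s * F (V s \o bump l.+1) = 0.
  set S := \sum_(s : _) _.
  (* Exchanging the values [l] and [l.+1] of [s] changes only the vertex [l.+1], which this face
     omits, and flips the sign. *)
  pose t := tperm (widen_ord (leqnSn i) l) (lift ord0 l).
  suff : S = - S by lia.
  rewrite {1}/S (reindex_inj (mulIg t)) -sumrN; apply: eq_bigr => s _ /=.
  have nt : widen_ord (leqnSn i) l != lift ord0 l.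
    by rewrite -(inj_eq val_inj) /= /bump /= neq_ltn ltnSn.
  rewrite odd_permM odd_tperm nt /= addbT signrN mulNr.
  congr (- (_ * F _)); apply/funext => j; rewrite /V /=.
  congr (g _); apply/ffunP => k; rewrite !ffunE permM /t.
  have /= := neq_bump l.+1 j; rewrite /bump => nb.
  by case: tpermP => [->|->|//] /=; rewrite /bump /=; lia.
rewrite big_ord_recl big_ord_recr /=.
under eq_bigr do rewrite mid mulr0.
rewrite [X in _ + (X + _)]big1 // add0r expr0 mul1r.
under [RHS]eq_bigr do rewrite mulrBr.
rewrite sumrB; congr (_ + _).
  rewrite (sum_lift_perm ord0); apply: eq_bigr => k _.
  rewrite mulr_sumr; apply: eq_bigr => s _.
  rewrite odd_lift_perm /= addbF signr_addb signr_odd -mulrA.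
  congr (_ * (_ * F _)); apply/funext => j; rewrite /V /=.
  congr (g _); apply/ffunP => k'; rewrite !ffunE.
  case: unliftP => [k1|] ->; last by rewrite lift_perm_id /bump /=; lia.
  by rewrite lift_perm_lift !ffunE /= /bump /=; lia.
rewrite (sum_lift_perm ord_max) mulr_sumr -sumrN; apply: eq_bigr => k _.
rewrite !mulr_sumr -sumrN; apply: eq_bigr => s _.
rewrite odd_lift_perm /= 2!signr_addb !signr_odd /bump /= add1n.
(* The two vertex sequences agree only up to index [i], whence the hypothesis on [F]. *)
have -> : F (V (lift_perm k ord_max s) \o (fun k0 => ((i < k0) + k0)%N)) =
   F (fun l => g (insb k false [ffun k0 => (s k0 < l)%N])).
  apply: Fext => l li; rewrite /V /=; congr (g _); apply/ffunP => k'; rewrite !ffunE.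
  case: unliftP => [k1|] ->; last by rewrite lift_perm_id /=; lia.
  rewrite lift_perm_lift !ffunE /= /bump /=; have := ltn_ord (s k1); lia.
set e := (-1) ^+ i; set a := (-1) ^+ k; set b := (-1) ^+ s; set f := F _.
have E : e * e = 1 by rewrite -expr2 sqrr_sign.
transitivity (- ((e * e) * (a * (b * f)))); last by rewrite E mul1r.
by rewrite exprS -/e; ring.
Qed.

End Kuhn.

(** * Stokes' formula and symmetries on the grid *)

Section Grid.
Variables (R : realType) (N : nat).
Local Notation cell := (bool * 'I_N)%type.

(* Cells are oriented away from the origin, so that negation preserves the
   ordering of the vertices of a cube of the grid. *)
Definition node (c : cell) (b : bool) : R := (-1) ^+ c.1 * (c.2 + b)%:R / N%:R.

Definition nodes i (c : {ffun 'I_i -> cell}) (B : {ffun 'I_i -> bool}) : 'rV[R]_i :=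
  \row_k node (c k) (B k).

Definition orientation i (c : {ffun 'I_i -> cell}) : int := \prod_k (-1) ^+ (c k).1.

Definition grid_sum X i (F : (nat -> X) -> int) (f : 'rV[R]_i -> X) : int :=
  \sum_c orientation c * kuhn F (fun B => f (nodes c B)).

Definition ins i (k : 'I_i.+1) (a : R) (u : 'rV[R]_i) : 'rV[R]_i.+1 :=
  \row_j (if unlift k j is Some j' then u ord0 j' else a).

Lemma grid_telescope (h : R -> int) : (0 < N)%N ->
  \sum_(c : cell) (-1) ^+ c.1 * (h (node c true) - h (node c false)) = h 1 - h (-1).
Proof.
move=> N0; rewrite -(pair_big xpredT xpredT
  (fun (b : bool) (j : 'I_N) => (-1) ^+ b * (h (node (b, j) true) - h (node (b, j) false)))) /=.
have tel (b : bool) : \sum_(j < N) (-1) ^+ b * (h (node (b, j) true) - h (node (b, j) false))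
    = (-1) ^+ b * (h ((-1) ^+ b) - h 0).
  rewrite -mulr_sumr; congr (_ * _).
  pose G j := h ((-1) ^+ b * j%:R / N%:R).
  rewrite -(big_mkord xpredT (fun j => G (j + true)%N - G (j + false)%N)).
  under eq_bigr do rewrite addn0 addn1.
  rewrite telescope_sumr // /G mulr0 mul0r mulfK //.
  by rewrite pnatr_eq0 -lt0n.
by rewrite big_bool !tel /= !expr0 !expr1; ring.
Qed.

(** In each direction [k] the rows of cubes telescope by [grid_telescope], which leaves the two
    outer facets. *)
Lemma grid_boundary X i (F : (nat -> X) -> int) (f : 'rV[R]_i.+1 -> X) :
  (0 < N)%N ->
  (forall v w, (forall l, (l <= i)%N -> v l = w l) -> F v = F w) ->
  grid_sum (fun v => \sum_(l < i.+2) (-1) ^+ l * F (v \o bump l)) f =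
  \sum_(k < i.+1) (-1) ^+ k *
     (grid_sum F (f \o ins k 1) - grid_sum F (f \o ins k (-1))).
Proof.
move=> N0 Fext; rewrite /grid_sum.
under eq_bigr do rewrite kuhn_boundary // mulr_sumr.
rewrite exchange_big; apply: eq_bigr => k _ /=.
under eq_bigr do rewrite mulrCA; rewrite -mulr_sumr; congr (_ * _).
pose e (p : cell * {ffun 'I_i -> cell}) :=
  [ffun j => if unlift k j is Some j' then p.2 j' else p.1].
rewrite (reindex e) /=; last first.
  exists (fun c => (c k, [ffun j => c (lift k j)])) => [[a c] _|c _].
    rewrite /e ffunE unlift_none; congr (_, _).
    by apply/ffunP => j; rewrite !ffunE liftK.
  by apply/ffunP => j; rewrite ffunE /=; case: unliftP => [j'|] -> //; rewrite ffunE.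
pose h c a := kuhn F (fun B => f (ins k a (nodes c B))).
rewrite -(pair_big xpredT xpredT
  (fun (a : cell) (c : {ffun 'I_i -> cell}) => orientation (e (a, c)) *
  (kuhn F ((fun B => f (nodes (e (a, c)) B)) \o insb k true) -
   kuhn F ((fun B => f (nodes (e (a, c)) B)) \o insb k false)))) /=.
rewrite exchange_big /= -sumrB; apply: eq_bigr => c _.
rewrite -mulrBr -(grid_telescope (h c)) // mulr_sumr; apply: eq_bigr => a _.
have -> : orientation (e (a, c)) = (-1) ^+ a.1 * orientation c.
  rewrite /orientation (bigD1_ord k) //= ffunE unlift_none; congr (_ * _).
  by apply: eq_bigr => j _; rewrite ffunE liftK.
have E b : kuhn F ((fun B => f (nodes (e (a, c)) B)) \o insb k b) = h c (node a b).
  apply: eq_bigr => s _; congr (_ * F _); apply/funext => l /=; congr (f _).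
  apply/rowP => j; rewrite !mxE !ffunE.
by case: unliftP => [j' _|_] //; rewrite ffunE /= mxE ffunE.
by rewrite !E mulrA [_ * orientation c]mulrC.
Qed.


Lemma norm_rV_leP i (u : 'rV[R]_i) r : 0 <= r ->
  reflect (forall k, `|u ord0 k| <= r) (`|u| <= r).
Proof.
move=> r0; rewrite [leLHS]/Num.Def.normr/= mx_normrE; apply: (iffP idP) => [/bigmax_leP[_ h] k|h].
  exact: (h (ord0, k)).
by apply: bigmax_le => // -[a k] _; rewrite ord1.
Qed.

Lemma le_coord_norm i (u : 'rV[R]_i) k : `|u ord0 k| <= `|u|.
Proof. by move: k; apply/norm_rV_leP. Qed.

Lemma norm_nodes i (c : {ffun 'I_i -> cell}) B : (0 < N)%N -> `|nodes c B| <= 1.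
Proof.
move=> N0; apply/norm_rV_leP => // k; rewrite mxE /node.
have Npos : 0 < N%:R :> R by rewrite ltr0n.
rewrite normrM normrM normr_sign mul1r normfV !ger0_norm ?ler0n //.
by rewrite ler_pdivrMr // mul1r ler_nat; case: (B k) (ltn_ord (c k).2) => /=; lia.
Qed.

Lemma eq_grid_sum X i (F : (nat -> X) -> int) (f f' : 'rV[R]_i -> X) :
  (0 < N)%N -> (forall u : 'rV[R]_i, `|u| <= 1 -> f u = f' u) -> grid_sum F f = grid_sum F f'.
Proof.
move=> N0 ff'; apply: eq_bigr => c _; congr (_ * _); apply: eq_bigr => s _.
by congr (_ * F _); apply/funext => l; rewrite ff' // norm_nodes.
Qed.

Definition signed i (e : {ffun 'I_i -> bool}) (u : 'rV[R]_i) : 'rV[R]_i :=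
  \row_k ((-1) ^+ e k * u ord0 k).

(** As cells point away from the origin, sign changes permute them and keep the vertex order of each
    cube; only orientations change. *)
Lemma grid_sum_signed X i (F : (nat -> X) -> int) (f : 'rV[R]_i -> X) e :
  grid_sum F (f \o signed e) = (\prod_k (-1) ^+ e k) * grid_sum F f.
Proof.
pose h (c : {ffun 'I_i -> cell}) := [ffun k => (e k (+) (c k).1, (c k).2)].
have hK : involutive h.
  by move=> c; apply/ffunP => k; rewrite !ffunE /= addKb -surjective_pairing.
rewrite {1}/grid_sum (reindex_inj (inv_inj hK)) mulr_sumr; apply: eq_bigr => c _.
rewrite mulrA; congr (_ * _).
  by rewrite /orientation -big_split; apply: eq_bigr => k _; rewrite ffunE signr_addb.
apply: eq_bigr => s _; congr (_ * F _); apply/funext => l /=; congr (f _).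
by apply/rowP => k; rewrite !mxE !ffunE /node /= signr_addb !mulrA -expr2 sqrr_sign mul1r.
Qed.

Lemma grid_sum_opp X i (F : (nat -> X) -> int) (f : 'rV[R]_i -> X) :
  grid_sum F (f \o -%R) = (-1) ^+ i * grid_sum F f.
Proof.
have -> : f \o -%R = f \o signed [ffun=> true].
  by apply/funext => u /=; congr (f _); apply/rowP => k; rewrite !mxE ffunE mulN1r.
rewrite grid_sum_signed; congr (_ * _).
under eq_bigr do rewrite ffunE expr1.
by rewrite prodr_const card_ord.
Qed.

(* A grid map that does not depend on a coordinate is degenerate: each path of
   vertices stalls when it moves in the direction of that coordinate. *)
Lemma grid_kappa_degenerate i (f : 'rV[R]_i -> nat -> int) (k : 'I_i) : (0 < N)%N ->
  (forall u v : 'rV[R]_i, `|u| <= 1 -> `|v| <= 1 ->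
     (forall j, j != k -> u ord0 j = v ord0 j) -> f u = f v) ->
  grid_sum (@kappa i) f = 0.
Proof.
move=> N0 fk; apply: big1 => c _; rewrite [X in _ * X]big1 ?mulr0 // => s _.
rewrite /kappa /theta (bigD1 (s k)) //=.
rewrite (fk _ (nodes c [ffun k0 => (s k0 < s k)%N])) ?norm_nodes ?subrr ?mul0r ?mulr0 //.
move=> j jk; rewrite !mxE !ffunE; congr (node _ _).
have : s j != s k by rewrite (inj_eq perm_inj).
by rewrite -(inj_eq val_inj) /=; lia.
Qed.

Lemma grid_theta_small i (f : 'rV[R]_i -> nat -> int) :
  (forall c, exists2 j, (j < i)%N & forall B B', f (nodes c B) j = f (nodes c B') j) ->
  grid_sum (@theta i) f = 0.
Proof.
move=> small; apply: big1 => c _; rewrite [X in _ * X]big1 ?mulr0 // => s _.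
have [j ji fj] := small c.
rewrite /theta (bigD1 (Ordinal ji)) //= (fj _ [ffun=> false]).
by rewrite (fj [ffun k => (s k < j)%N] [ffun=> false]) subrr mul0r mulr0.
Qed.

(** Passing from p_j to 1 - p_j negates the [i] coboundaries and turns the last factor into 1 -
    p_i. *)
Lemma grid_kappa_compl i (f : 'rV[R]_i -> nat -> int) :
  grid_sum (@kappa i) (fun u j => 1 - f u j) =
  (-1) ^+ i * (grid_sum (@theta i) f - grid_sum (@kappa i) f).
Proof.
rewrite /grid_sum -sumrB mulr_sumr; apply: eq_bigr => c _.
rewrite -mulrBr [RHS]mulrCA; congr (_ * _); rewrite /kuhn -sumrB mulr_sumr.
apply: eq_bigr => s _; rewrite -mulrBr [RHS]mulrCA; congr (_ * _).
rewrite /kappa {1}/theta.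
have compl (a b : int) : (1 - a) - (1 - b) = -1 * (a - b) by ring.
under eq_bigr do rewrite compl.
rewrite big_split /= prodr_const card_ord /theta; ring.
Qed.

Lemma grid_theta_boundary i (f : 'rV[R]_i.+1 -> nat -> int) : (0 < N)%N ->
  grid_sum (@theta i.+1) f = (-1) ^+ i * \sum_(k < i.+1) (-1) ^+ k *
     (grid_sum (@kappa i) (f \o ins k 1) - grid_sum (@kappa i) (f \o ins k (-1))).
Proof.
move=> N0; rewrite -grid_boundary //; last exact: eq_kappa.
rewrite /grid_sum mulr_sumr; apply: eq_bigr => c _; rewrite mulrCA; congr (_ * _).
rewrite /kuhn mulr_sumr; apply: eq_bigr => s _; rewrite mulrCA; congr (_ * _).
by rewrite kappa_coboundary mulrA -expr2 sqrr_sign mul1r.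
Qed.

End Grid.

(** * Equivariant hemispheres: parity and homotopy invariance *)

Section Hemispheres.
Variables (R : realType) (X : Type) (om : X -> X) (n : nat).

Definition tail i (u : 'rV[R]_i.+1) : 'rV[R]_i := \row_j u ord0 (lift ord0 j).

Lemma tail_ins0 i a (u : 'rV[R]_i) : tail (ins ord0 a u) = u.
Proof. by apply/rowP => j; rewrite !mxE liftK. Qed.

Lemma ins0_head i a (u : 'rV[R]_i) : ins ord0 a u ord0 ord0 = a.
Proof. by rewrite mxE unlift_none. Qed.

Lemma ins_head_tail i (u : 'rV[R]_i.+1) : ins ord0 (u ord0 ord0) (tail u) = u.
Proof. by apply/rowP => j; rewrite mxE; case: unliftP => [j'|] -> //; rewrite mxE. Qed.

Lemma tail_ins_lift i (k : 'I_i.+1) a (u : 'rV[R]_i.+1) :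
  tail (ins (lift ord0 k) a u) = ins k a (tail u).
Proof.
apply/rowP => j; rewrite !mxE; case: (unliftP k j) => [j'|] ->; last first.
  by rewrite unlift_none.
have -> : lift ord0 (lift k j') = lift (lift ord0 k) (lift ord0 j').
  by apply/val_inj; rewrite /= /bump /=; lia.
by rewrite liftK mxE.
Qed.

Lemma ins_lift_head i (k : 'I_i.+1) a (u : 'rV[R]_i.+1) :
  ins (lift ord0 k) a u ord0 ord0 = u ord0 ord0.
Proof.
rewrite mxE; have -> : ord0 = lift (lift ord0 k) ord0 by apply/val_inj.
by rewrite liftK; congr (u _ _); apply/val_inj.
Qed.

Lemma tail_opp i (u : 'rV[R]_i.+1) : tail (- u) = - tail u.
Proof. by apply/rowP => j; rewrite !mxE. Qed.

Lemma ins_opp i (k : 'I_i.+1) a (u : 'rV[R]_i) : ins k (- a) (- u) = - ins k a u.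
Proof. by apply/rowP => j; rewrite !mxE; case: unliftP => // j' _; rewrite mxE. Qed.

Lemma norm_ins i (k : 'I_i.+1) a (u : 'rV[R]_i) : `|ins k a u| = Num.max `|a| `|u|.
Proof.
apply/eqP; rewrite eq_le ge_max; apply/and3P; split.
- apply/norm_rV_leP => [|j]; first by rewrite le_max normr_ge0.
  rewrite mxE le_max; case: unliftP => [j'|] _; last by rewrite lexx.
  by rewrite le_coord_norm orbT.
- by have := le_coord_norm (ins k a u) k; rewrite mxE unlift_none.
- apply/norm_rV_leP => // j.
  by have := le_coord_norm (ins k a u) (lift k j); rewrite mxE liftK.
Qed.

Lemma norm_tail i (u : 'rV[R]_i.+1) : `|tail u| <= `|u|.
Proof. by apply/norm_rV_leP => // j; rewrite mxE le_coord_norm. Qed.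

(* Hemispheres of the spheres of dimension at most n: the restriction of
   E i.+1 to the boundary of its cube is the union of E i, as the upper
   hemisphere, and of its antipodal image. *)
Definition hemispheres (E : forall i, 'rV[R]_i -> X) : Prop :=
  forall i b (u : 'rV[R]_i), (i < n)%N -> `|ins ord0 b u| = 1 ->
    E i.+1 (ins ord0 b u) = if 0 <= b then E i u else om (E i (- u)).

Hypothesis omK : involutive om.
Variable E : forall i, 'rV[R]_i -> X.
Hypothesis hE : hemispheres E.

(** Off the equator, antipodes lie on opposite hemispheres; on it, the claim is that for one
    coordinate less. With no coordinates the sphere is empty. *)
Lemma hemispheres_odd i (u : 'rV[R]_i) : (i <= n)%N -> `|u| = 1 -> E (- u) = om (E u).
Proof.
elim: i u => [|i IHi] u ltin u1.
  by move: u1; rewrite [u]thinmx0 normr0 => /esym/eqP; rewrite oner_eq0.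
have v1 : `|ins ord0 (u ord0 ord0) (tail u)| = 1 by rewrite ins_head_tail.
rewrite -(ins_head_tail u) -ins_opp !hE //; last by rewrite ins_opp normrN.
have [b0|b0|b0] := ltrgtP 0 (u ord0 ord0).
- by rewrite oppr_ge0 (lt_geF b0) opprK.
- by rewrite oppr_ge0 ltW // omK.
- move: v1; rewrite -b0 oppr0 lexx norm_ins normr0 max_r // => v1.
  by rewrite IHi // ltnW.
Qed.

(** Both hemispheres agree here because [E] is odd one dimension lower. The head coordinate is thus
    forgotten, which makes lateral facets degenerate. *)
Lemma hemispheres_lateral i (k : 'I_i.+1) a (u : 'rV[R]_i.+1) :
  (i.+1 < n)%N -> `|a| = 1 -> `|u| <= 1 ->
  E (ins (lift ord0 k) a u) = E (ins k a (tail u)).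
Proof.
move=> lein a1 u1; rewrite -(ins_head_tail (ins _ _ u)).
rewrite tail_ins_lift ins_lift_head.
have t1 : `|ins k a (tail u)| = 1.
  by rewrite norm_ins a1 max_l // (le_trans (norm_tail u)).
have h1 : `|u ord0 ord0| <= 1 by rewrite (le_trans (le_coord_norm _ _)).
rewrite hE //; last by rewrite norm_ins t1 max_r.
by case: ifP => // _; rewrite hemispheres_odd ?omK // ltnW.
Qed.

Variable N : nat.
Hypothesis N0 : (0 < N)%N.

Section Parity.
Variable be : X -> nat -> int.
Hypothesis be_om : forall i (u : 'rV[R]_i) j, (i <= n)%N -> `|u| <= 1 ->
  be (om (E u)) j = 1 - be (E u) j.

(** Borsuk-Ulam parity: only the two facets of the head coordinate contribute to the boundary, and
    up to sign they give [2 * b - A], with [A] the odd sum one dimension lower and [b] a sum of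
    [kappa i]. *)
Lemma odd_grid_theta i : (i <= n)%N ->
  exists z, grid_sum N (@theta i) (fun u => be (@E i u)) = 2 * z + 1.
Proof.
elim: i => [|i IHi] lein.
  exists 0; rewrite /grid_sum /kuhn /orientation /theta.
  under eq_bigr => c _.
    rewrite big_ord0 mul1r.
    under eq_bigr => s _ do rewrite big_ord0 mulr1.
    rewrite (_ : \sum_s _ = 1); last first.
      rewrite (bigD1 1%g) //= odd_perm1 big1 ?addr0 // => s.
      by move/eqP; case; apply/permP => -[].
    over.
  by rewrite sumr_const card_ffun card_ord expn0.
have [z Az] := IHi (ltnW lein).
rewrite grid_theta_boundary // big_ord_recl [X in _ + X]big1 ?addr0; last first.
  case: i {IHi z Az} lein => [|i] lein k _; first by case: k.
  rewrite !(@grid_kappa_degenerate _ _ _ _ ord0) ?subrr ?mulr0 // => u v u1 v1 uv /=.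
    rewrite !hemispheres_lateral ?normrN1 //; congr (be (E (ins _ _ _))).
    by apply/rowP => j; rewrite !mxE uv.
  rewrite !hemispheres_lateral ?normr1 //; congr (be (E (ins _ _ _))).
  by apply/rowP => j; rewrite !mxE uv.
rewrite expr0 mul1r.
rewrite (@eq_grid_sum _ _ _ _ _ _ (fun u => be (E u))) //; last first.
  by move=> u u1; rewrite /= hE ?ler01 // norm_ins normr1 max_l.
rewrite (@eq_grid_sum _ _ _ _ _ (_ \o ins ord0 (-1))
  ((fun u j => 1 - be (E u) j) \o -%R)) //; last first.
  move=> u u1 /=; apply/funext => j; rewrite hE //; last by rewrite norm_ins normrN1 max_l.
  by rewrite ler0N1 be_om ?normrN // ltnW.
rewrite grid_sum_opp grid_kappa_compl Az mulrA -expr2 sqrr_sign mul1r.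
set b := grid_sum _ _ _; have [e|e] : (-1) ^+ i = 1 :> int \/ (-1) ^+ i = -1 :> int.
- by rewrite -signr_odd; case: odd; [right|left].
- by rewrite e; exists (b - z - 1); ring.
- by rewrite e; exists (- b + z); ring.
Qed.

End Parity.

Section Transport.
Implicit Types (H : R -> X -> nat -> int).

(** The head coordinate is the time of a homotopy, running from -1 to 1. *)
Definition track i H (u : 'rV[R]_i.+1) := H (u ord0 ord0) (E (tail u)).

Lemma track_face0 i H a :
  @track i H \o ins ord0 a = fun u : 'rV[R]_i => H a (E u).
Proof. by apply/funext => u; rewrite /track /= ins0_head tail_ins0. Qed.

(** Boundary of a prism: beside its two ends, only the facets of the coordinate after the time
    count, one for each hemisphere. The lower one is read through the negation of [m] coordinates,
    of sign -1 as [m] is odd, so the two contributions add. Their sum is unchanged when [H] is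
    composed with [om], which lets it cancel in a difference. *)
Lemma grid_track_boundary m H : m.+1 = n -> odd m ->
  grid_sum N (@theta m.+2) (@track m.+1 H) = 0 ->
  grid_sum N (@kappa m.+1) (fun u => H 1 (@E m.+1 u))
    - grid_sum N (@kappa m.+1) (fun u => H (-1) (@E m.+1 u))
  = grid_sum N (@kappa m.+1) (@track m H)
    + grid_sum N (@kappa m.+1) (@track m (fun t p => H t (om p))).
Proof.
move=> mn om_ /eqP; rewrite grid_theta_boundary // mulf_eq0 signr_eq0 /=.
rewrite big_ord_recl !track_face0 expr0 mul1r addr_eq0 => /eqP ->.
rewrite big_ord_recl [X in _ + X]big1 ?addr0; last first.
  move=> k _; case: m mn om_ k => [|m] mn om_ k; first by case: k.
  have deg a : `|a| = 1 ->
      grid_sum N (@kappa m.+2) (@track m.+2 H \o ins (lift ord0 (lift ord0 k)) a) = 0.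
    move=> a1; apply: (@grid_kappa_degenerate _ _ _ _ (lift ord0 ord0)) => // u v u1 v1 uv.
    have tu := le_trans (norm_tail u) u1; have tv := le_trans (norm_tail v) v1.
    rewrite /track /= !ins_lift_head !tail_ins_lift !hemispheres_lateral ?mn //.
    rewrite (uv ord0) //; congr (H _ (E (ins k a _))).
    by apply/rowP => j; rewrite !mxE uv.
  by rewrite !deg ?normrN1 ?normr1 // subrr mulr0.
rewrite /= expr1 mulN1r opprK.
rewrite (@eq_grid_sum _ _ _ _ _ (_ \o ins _ 1) (@track m H)) //; last first.
  move=> u u1; rewrite /track /= ins_lift_head tail_ins_lift hE ?mn //; first by rewrite ler01.
  by rewrite norm_ins normr1 max_l // (le_trans (norm_tail u)).
pose e := [ffun j : 'I_m.+1 => j != ord0].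
rewrite (@eq_grid_sum _ _ _ _ _ (_ \o ins _ (-1))
  (@track m (fun t p => H t (om p)) \o signed e)) //; last first.
  move=> u u1; rewrite /track /= ins_lift_head tail_ins_lift hE ?mn //; last first.
    by rewrite norm_ins normrN1 max_l // (le_trans (norm_tail u)).
  have -> : signed e u ord0 ord0 = u ord0 ord0 by rewrite mxE ffunE expr0 mul1r.
  rewrite ler0N1; congr (H _ (om (E _))).
  by apply/rowP => j; rewrite !mxE ffunE /= mulN1r.
rewrite grid_sum_signed big_ord_recl ffunE expr0 mul1r.
under eq_bigr do rewrite ffunE expr1.
by rewrite prodr_const card_ord -signr_odd om_ mulN1r opprK.
Qed.

(* Homotopy invariance of the degree: the two terms of a difference are the
   contributions of the two hemispheres. *)
Lemma grid_kappa_transport H : ~~ odd n ->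
  grid_sum N (@theta n.+1) (@track n H) = 0 ->
  grid_sum N (@theta n.+1) (@track n (fun t p => H t (om p))) = 0 ->
  grid_sum N (@kappa n) (fun u => H 1 (@E n u))
    - grid_sum N (@kappa n) (fun u => H 1 (om (@E n u))) =
  grid_sum N (@kappa n) (fun u => H (-1) (@E n u))
    - grid_sum N (@kappa n) (fun u => H (-1) (om (@E n u))).
Proof.
(* For [n = 0] the prism is an interval and has no lateral facets. *)
have [n0|[m mn]] : n = 0 \/ exists m, m.+1 = n.
  by case: n => [|m]; [left|right; exists m].
  move=> nev tH tHom.
  have B0 H' : grid_sum N (@theta n.+1) (@track n H') = 0 ->
      grid_sum N (@kappa n) (fun u => H' 1 (@E n u)) =
      grid_sum N (@kappa n) (fun u => H' (-1) (@E n u)).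
    move/eqP; rewrite grid_theta_boundary // mulf_eq0 signr_eq0 /=.
    rewrite big_ord_recl [X in _ + X]big1 ?addr0 => [|[k]]; last by rewrite n0.
    by rewrite expr0 mul1r !track_face0 subr_eq0 => /eqP.
  by rewrite (B0 _ tH) (B0 _ tHom).
rewrite -mn => nev tH tHom.
have modd : odd m by move: nev; rewrite /= negbK.
have := grid_track_boundary mn modd tHom.
have -> : (fun (t : R) p => H t (om (om p))) = H.
  by apply/funext => t; apply/funext => p; rewrite omK.
have := grid_track_boundary mn modd tH; lia.
Qed.

End Transport.

End Hemispheres.

Local Open Scope classical_set_scope.

(** * Extension of maps from spheres to discs *)

Lemma within_comp (S T U : topologicalType) (A : set S) (B : set T)
    (p : S -> T) (g : T -> U) :
  {within A, continuous p} -> {within B, continuous g} -> p @` A `<=` B ->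
  {within A, continuous (g \o p)}.
Proof.
move=> /subspace_continuousP pc /subspace_continuousP gc pAB.
apply/subspace_continuousP => x Ax.
have Bpx : B (p x) by apply: pAB; exists x.
move=> V /(gc _ Bpx) /= gV; have := pc x Ax _ gV; rewrite /= !nbhs_simpl /=.
apply: filter_app; rewrite /within /=; near=> y => Ay h.
by apply: h; apply: pAB; exists y.
Unshelve. all: by end_near. Qed.

Lemma quotient_extension (S Y X : topologicalType) (K : set S) (Q : S -> Y) (h : S -> X) :
  K !=set0 -> compact K -> hausdorff_space Y ->
  {within K, continuous Q} -> {within K, continuous h} ->
  (forall a b, K a -> K b -> Q a = Q b -> h a = h b) ->
  exists E : Y -> X, (forall a, K a -> E (Q a) = h a) /\ {within Q @` K, continuous E}.
Proof.
move=> [a0 _] cK hY cQ ch hQ.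
pose E y := h (xget a0 [set a | K a /\ Q a = y]).
have EQ a : K a -> E (Q a) = h a.
  move=> Ka; rewrite /E; case: xgetP => [b _ [Kb Qb]|/(_ a)]; first exact: hQ.
  by case.
exists E; split => //; apply/continuous_closedP => C cC.
have /closed_subspaceP[V cV VK] : closed (h @^-1` C : set (subspace K)).
  by move/continuous_closedP: ch; apply.
apply/closed_subspaceP; exists (Q @` (V `&` K)).
  apply: compact_closed => //; apply: continuous_compact.
    by apply: continuous_subspaceW cQ; exact: subIsetr.
  by rewrite setIC; exact: compact_closedI.
rewrite eqEsubset; split => y [].
  move=> [a [Va Ka] <-] _; split; last by exists a.
  suff : C (E (Q a)) by [].
  by rewrite EQ //; have : (V `&` K) a by []; rewrite VK => -[].
move=> /= Ey [a Ka Qa]; split; last by exists a.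
exists a => //; suff : (V `&` K) a by []; rewrite VK; split => //.
by suff : C (h a) by []; rewrite -EQ // Qa.
Qed.

(** * Wrapping a cube around the boundary of the next one *)

Section Real.
Variable R : realType.

Lemma continuous_rV (S : topologicalType) i (f : S -> 'rV[R]_i) :
  (forall k, continuous (fun s => f s ord0 k)) -> continuous f.
Proof.
move=> fc s A [P MP sPA]; rewrite nbhs_simpl /=.
have : \forall t \near s, forall k, P ord0 k (f t ord0 k).
  by apply: filter_forall => k; apply: (fc k s); exact: MP.
by apply: filterS => t h; apply: sPA => a k; rewrite ord1.
Qed.

Lemma continuous_ins i (k : 'I_i.+1) (S : topologicalType) (a : S -> R) (u : S -> 'rV[R]_i) :
  continuous a -> continuous u -> continuous (fun s => ins k (a s) (u s)).
Proof.
move=> ac uc; apply: continuous_rV => j.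
case: (unliftP k j) => [j'|] ->.
  have -> : (fun s => ins k (a s) (u s) ord0 (lift k j')) = (fun M : 'rV[R]_i => M ord0 j') \o u.
    by apply/funext => s /=; rewrite mxE liftK.
  by move=> s; apply: continuous_comp; [exact: uc|exact: coord_continuous].
have -> // : (fun s => ins k (a s) (u s) ord0 k) = a.
by apply/funext => s /=; rewrite mxE unlift_none.
Qed.

Lemma continuous_tail i : continuous (@tail R i).
Proof.
apply: continuous_rV => k.
have -> : (fun u => @tail R i u ord0 k) = (fun u => u ord0 (lift ord0 k)).
  by apply/funext => u; rewrite mxE.
exact: coord_continuous.
Qed.

(* The map v |-> wrap v wraps the cube of radius 3 around the boundary of the
   unit cube of the next dimension: as the norm of v grows, wrap v runs through
   the bottom face, climbs the lateral faces, and moves on the top face to its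
   centre, to which the whole boundary of the cube is sent. *)
Definition height (r : R) : R := Num.max (-1) (Num.min 1 (r *+ 2 - 3)).
Definition radius (r : R) : R := Num.min 1 (3 - r) / Num.max 1 r.
Definition wrap i (v : 'rV[R]_i) : 'rV[R]_i.+1 := ins ord0 (height `|v|) (radius `|v| *: v).

Lemma continuous_height : continuous height.
Proof.
move=> r; apply: (@continuous_max R R (cst (-1)) (fun r => Num.min 1 (r *+ 2 - 3)) r).
  exact: cst_continuous.
apply: (@continuous_min R R (cst 1) (fun r => r *+ 2 - 3) r); first exact: cst_continuous.
by apply: cvgB; [apply: cvgMn; exact: cvg_id|exact: cvg_cst].
Qed.

Lemma continuous_radius : continuous radius.
Proof.
move=> r; apply: cvgM.
  apply: (@continuous_min R R (cst 1) (fun r => 3 - r) r); first exact: cst_continuous.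
  by apply: cvgB; [exact: cvg_cst|exact: cvg_id].
apply: cvgV; first by rewrite gt_eqF // lt_max ltr01.
by apply: (@continuous_max R R (cst 1) id r); [exact: cst_continuous|exact: cvg_id].
Qed.

Lemma continuous_wrap i : continuous (@wrap i).
Proof.
have cn : continuous (fun v : 'rV[R]_i => `|v|) by exact: norm_continuous.
apply: continuous_ins => v.
  exact: (@continuous_comp _ _ _ (fun v : 'rV[R]_i => `|v|) height v (cn v) (@continuous_height _)).
have cr : continuous (fun v : 'rV[R]_i => radius `|v|).
  move=> w.
  exact: (@continuous_comp _ _ _ (fun v : 'rV[R]_i => `|v|) radius w (cn w) (@continuous_radius _)).
by apply: (@cvgZ _ _ _ (nbhs v)); [exact: cr|exact: cvg_id].
Qed.

Lemma radiusE (r : R) : 0 <= r <= 3 ->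
  [/\ r <= 1, height r = -1 & radius r * r = r]
  \/ [/\ 1 <= r <= 2, height r = r *+ 2 - 3 & radius r * r = 1]
  \/ [/\ 2 <= r, height r = 1 & radius r * r = 3 - r].
Proof.
move=> /andP[r0 r3]; have [r1|r1] := lerP r 1.
  rewrite /height /radius; left; split=> //; last by rewrite max_l // divr1 min_l ?mul1r //; lra.
  by rewrite min_r ?max_l //; lra.
have [r2|r2] := lerP r 2; rewrite /height /radius.
  right; left; split; rewrite ?(ltW r1) //.
    by rewrite min_r ?max_r //; lra.
  by rewrite max_r ?(ltW r1) // min_l ?divfK //; lra.
right; right; split; first exact: ltW.
  by rewrite min_l ?max_r //; lra.
by rewrite max_r ?(ltW r1) // min_r ?divfK //; lra.
Qed.

Lemma radius_ge0 (r : R) : r <= 3 -> 0 <= radius r.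
Proof. by move=> r3; rewrite divr_ge0 // ?le_min ?le_max ?ler01 ?subr_ge0. Qed.

Lemma norm_wrap i (v : 'rV[R]_i) : `|v| <= 3 -> `|wrap v| = 1.
Proof.
move=> v3; rewrite norm_ins normrZ (ger0_norm (radius_ge0 v3)).
have v03 : 0 <= `|v| <= 3 by rewrite normr_ge0.
have [[v1 -> ->]|[[/andP[v1 v2] -> ->]|[v2 -> ->]]] := radiusE v03.
- by rewrite normrN1 max_l.
- by rewrite max_r // ler_norml; lra.
- by rewrite normr1 max_l //; lra.
Qed.

(** The height and the norm of the tail determine the norm of the argument; the scaling by [radius]
    is then inverted, as it vanishes only at norm 3. *)
Lemma wrap_inj i (v w : 'rV[R]_i) : `|v| <= 3 -> `|w| <= 3 ->
  wrap v = wrap w -> v = w \/ `|v| = 3 /\ `|w| = 3.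
Proof.
move=> v3 w3 vw.
have := congr1 (fun u : 'rV_i.+1 => u ord0 ord0) vw; rewrite !ins0_head => hh.
have := congr1 (@tail R i) vw; rewrite !tail_ins0 => tt.
have : `|radius `|v| *: v| = `|radius `|w| *: w| by rewrite tt.
rewrite (normrZ _ v) (normrZ _ w) (ger0_norm (radius_ge0 v3)) (ger0_norm (radius_ge0 w3)) => rr.
have v03 : 0 <= `|v| <= 3 by rewrite normr_ge0.
have w03 : 0 <= `|w| <= 3 by rewrite normr_ge0.
have nvw : `|v| = `|w|.
  have [[v1 hv rv]|[[/andP[v1 v2] hv rv]|[v2 hv rv]]] := radiusE v03;
  have [[w1 hw rw]|[[/andP[w1 w2] hw rw]|[w2 hw rw]]] := radiusE w03;
  move: hh rr; rewrite hv hw rv rw; lra.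
move: tt; rewrite nvw; have [w3'|w3'] := ltrP `|w| 3; last first.
  by right; split; apply/le_anti; rewrite ?nvw w3 w3'.
left; apply: (scalerI _ tt); rewrite gt_eqF // divr_gt0 // ?lt_min ?lt_max ?ltr01 ?subr_gt0 //.
Qed.

(** The target has at least two coordinates, since from a space without coordinates [wrap] only
    reaches -1. The cases are the bottom, the centre of the top, the rest of the top, and the
    sides. *)
Lemma wrap_surj i (w : 'rV[R]_i.+2) : `|w| = 1 -> exists2 v, `|v| <= 3 & wrap v = w.
Proof.
rewrite -(ins_head_tail w); set b := w _ _; set u := tail w; rewrite norm_ins => w1.
have b1 : `|b| <= 1 by rewrite -w1 le_max lexx.
have u1 : `|u| <= 1 by rewrite -w1 le_max lexx orbT.
have wrapE (v : 'rV[R]_i.+1) : height `|v| = b -> radius `|v| *: v = u ->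
    wrap v = ins ord0 b u by rewrite /wrap => -> ->.
have [b'|b'] := eqVneq b (-1).
  exists u; first by lra.
  apply: wrapE; rewrite ?b' /height /radius; first by rewrite min_r ?max_l //; lra.
  by rewrite max_l // min_l ?divr1 ?scale1r //; lra.
have [b''|b''] := eqVneq b 1.
  have [u0|u0] := eqVneq u 0.
    have n3 : `|const_mx 3 : 'rV[R]_i.+1| = 3.
      apply/le_anti/andP; split; first by apply/norm_rV_leP => // k; rewrite mxE ger0_norm.
      by have := le_coord_norm (const_mx 3 : 'rV[R]_i.+1) ord0; rewrite mxE ger0_norm.
    exists (const_mx 3); first by rewrite n3.
    apply: wrapE; rewrite n3 ?b'' ?u0 /height /radius; first by rewrite min_l ?max_r //; lra.
    by rewrite subrr min_r // mul0r scale0r.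
  have nu : 0 < `|u| by rewrite normr_gt0.
  have nv : `|(3 - `|u|) / `|u| *: u| = 3 - `|u|.
    by rewrite normrZ normrM normfV normr_id ger0_norm ?divfK ?gt_eqF //; lra.
  exists ((3 - `|u|) / `|u| *: u); rewrite ?nv; first by lra.
  apply: wrapE; rewrite nv ?b'' /height /radius; first by rewrite min_l ?max_r //; lra.
  rewrite scalerA min_r ?max_r; [|lra|lra].
  rewrite [X in X *: _](_ : _ = 1) ?scale1r //.
  have n0 : `|u| != 0 by rewrite gt_eqF.
  have n1 : 3 - `|u| != 0 by rewrite gt_eqF; lra.
  by field; rewrite n0 n1.
have b3 : `|b| < 1.
  rewrite lt_neqAle b1 andbT; apply/negP; rewrite eqr_norml ler01 andbT.
  by rewrite (negPf b') (negPf b'').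
have {w1 u1} u1 : `|u| = 1.
  by move: w1; rewrite maxEle; case: ifP => // _; lra.
move: b3; rewrite ltr_norml => /andP[b3 b4].
(* The norm [(b + 3) / 2] solves [r *+ 2 - 3 = b], the height on the lateral faces. *)
have nv : `|(b + 3) / 2 *: u| = (b + 3) / 2.
  by rewrite normrZ u1 mulr1 ger0_norm //; lra.
exists ((b + 3) / 2 *: u); rewrite ?nv; first by lra.
apply: wrapE; rewrite nv /height /radius; first by rewrite min_r ?max_r //; lra.
rewrite scalerA min_l ?max_r; [|lra|lra].
rewrite [X in X *: _](_ : _ = 1) ?scale1r // mul1r mulVf // gt_eqF //; lra.
Qed.

End Real.

(** * Extension over the disc from trivial homotopy groups *)

Section Extension.
Variables (R : realType) (X : topologicalType) (A : set X).

(** In the maximum norm, the disc is a cube and the sphere its boundary. *)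
Definition disc i : set 'rV[R]_i := [set w | `|w| <= 1].
Definition sphere i : set 'rV[R]_i := [set w | `|w| = 1].

(** Carries the unit cube of the homotopy groups onto the cube of radius 3 on which [wrap] is
    studied. *)
Definition stretch i (c : 'rV[R]_i) : 'rV[R]_i := \row_k (c ord0 k *+ 6 - 3).

Lemma stretchE i (c : 'rV[R]_i) k : stretch c ord0 k = c ord0 k *+ 6 - 3.
Proof. by rewrite mxE. Qed.

Lemma stretch_inj i : injective (@stretch i).
Proof.
move=> c c' cc; apply/rowP => k.
by have := congr1 (fun u : 'rV[R]_i => u ord0 k) cc; rewrite !stretchE; lra.
Qed.

Lemma continuous_stretch i : continuous (@stretch i).
Proof.
apply: continuous_rV => k.
have -> : (fun c : 'rV[R]_i => stretch c ord0 k) = (fun c => c ord0 k *+ 6 - 3).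
  by apply/funext => c; rewrite stretchE.
move=> c; apply: (@cvgB _ _ _ (nbhs c)); last exact: cvg_cst.
by apply: (@cvgMn _ _ _ (nbhs c)); exact: coord_continuous.
Qed.

Lemma stretch_cube i (c : 'rV[R]_i) : cube c <-> `|stretch c| <= 3.
Proof.
split=> [cc|/norm_rV_leP c3 k].
  apply/norm_rV_leP => // k; rewrite stretchE ler_norml; have := cc k; lra.
by have := c3 (ler0n R 3) k; rewrite stretchE ler_norml; lra.
Qed.

Lemma stretch_surj i (v : 'rV[R]_i) : `|v| <= 3 -> exists2 c, cube c & stretch c = v.
Proof.
move=> v3; exists (\row_k ((v ord0 k + 3) / 6)).
  move=> k; rewrite mxE; have := le_coord_norm v k; rewrite ler_norml => /andP[]; lra.
by apply/rowP => k; rewrite stretchE mxE; lra.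
Qed.

Lemma stretch_boundary i (c : 'rV[R]_i.+1) : `|stretch c| = 3 -> cube_boundary c.
Proof.
move=> c3; have cc : cube c by apply/stretch_cube; rewrite c3.
split=> //; apply: contrapT => /forallNP nc.
suff : `|stretch c| < 3 by rewrite c3 ltxx.
have lt3 k : `|stretch c ord0 k| < 3.
  have /not_orP[c0 c1] := nc k; have /andP[c0' c1'] := cc k.
  have {c0 c0'} c0 : 0 < c ord0 k by rewrite lt_neqAle c0' andbT; apply/eqP => /esym.
  have {c1 c1'} c1 : c ord0 k < 1 by rewrite lt_neqAle c1' andbT; apply/eqP.
  by rewrite stretchE ltr_norml; lra.
rewrite [ltLHS]/Num.Def.normr /= mx_normrE; apply: bigmax_lt => // -[a k] _.
by rewrite ord1.
Qed.

Lemma compact_cylinder i : compact (`[0, 1]%classic `*` @cube R i : set (R * 'rV[R]_i)).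
Proof.
apply: compact_setX; first exact: segment_compact.
have := @rV_compact R i (fun=> `[0, 1]%classic) (fun=> @segment_compact _ _ _).
congr compact; rewrite predeqE => v; split => h k; have := h k; by rewrite /= in_itv.
Qed.

(** The sphere is two points; a homotopy between the constant 0-cubes at their images is a path that
    extends [g]. *)
Lemma extend_disc0 (g : 'rV[R]_1 -> X) :
  (forall x0, A x0 -> trivial_homotopy_group R A 0 x0) ->
  (forall w, sphere w -> A (g w)) ->
  exists E : 'rV[R]_1 -> X, [/\ {within @disc 1, continuous E},
    forall w, disc w -> A (E w) & forall w, sphere w -> E w = g w].
Proof.
move=> trivA gA.
pose pole (a : R) := ins ord0 a (0 : 'rV[R]_0).
have polew (w : 'rV[R]_1) : w = pole (w ord0 ord0).
  by rewrite -{1}(ins_head_tail w) [tail w]thinmx0.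
have Ag (a : R) : `|a| = 1 -> A (g (pole a)).
  by move=> a1; apply: gA; rewrite /sphere /= norm_ins a1 max_l ?normr0.
have based a : `|a| = 1 -> based_cube A (g (pole 1)) (fun _ : 'rV[R]_0 => g (pole a)).
  move=> a1; split.
  - by apply: continuous_subspaceT; exact: cst_continuous.
  - by move=> _ [v _ <-]; exact: Ag.
  - by move=> v [_ [[]]].
have [H [Hc H0 H1 Hb]] := trivA _ (Ag 1 (normr1 _)) _ _ (based _ (normrN1 _)) (based _ (normr1 _)).
pose Q (p : R * 'rV[R]_0) := pole (p.1 *+ 2 - 1).
pose K : set (R * 'rV[R]_0) := `[0, 1]%classic `*` @cube R 0.
have Qsurj (w : 'rV[R]_1) : disc w -> exists2 p, K p & Q p = w.
  move=> w1; exists ((w ord0 ord0 + 1) / 2, 0).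
    split=> /=; last by move=> [].
    by rewrite in_itv /=; have := le_trans (le_coord_norm w ord0) w1; rewrite ler_norml; lra.
  by rewrite [RHS]polew /Q /=; congr (pole _); lra.
have [|||||| E [EQ Ec]] := @quotient_extension _ _ X K Q H.
- by have [|p Kp _] := Qsurj 0; [rewrite /disc /= normr0|exists p].
- exact: compact_cylinder.
- exact: norm_hausdorff.
- apply: continuous_subspaceT => p; apply: continuous_ins => q; last exact: cst_continuous.
  by apply: (@cvgB _ _ _ (nbhs q)); [apply: (@cvgMn _ _ _ (nbhs q)); exact: cvg_fst|exact: cvg_cst].
- exact: Hc.
- move=> [t c] [t' c'] _ _ /(congr1 (fun u : 'rV[R]_1 => u ord0 ord0)); rewrite !ins0_head /= => tt.
  have -> : t = t' by lra.
  by rewrite [c]thinmx0 [c']thinmx0.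
exists E; split.
- by apply: continuous_subspaceW Ec => w /Qsurj[p Kp <-]; exists p.
- move=> w /Qsurj[[t c] [/= t01 cc] <-]; rewrite EQ //.
  have [_ HA _] : based_cube A (g (pole 1)) (fun v => H (t, v)).
    by apply: Hb; move: t01; rewrite in_itv.
  by apply: HA; exists c.
- move=> w w1; have c0 : @cube R 0 0 by move=> [].
  have /eqP : `|w ord0 ord0| = 1.
    by move: w1; rewrite {1}(polew w) /sphere /= norm_ins normr0 max_l.
  rewrite eqr_norml ler01 andbT => /orP[] /eqP e; rewrite (polew w) e.
    have -> : pole 1 = Q (1, 0) by rewrite /Q /=; congr (pole _); lra.
    by rewrite EQ ?H1 //; [congr (g (pole _)); rewrite /=; lra|
      split => //=; rewrite in_itv /=; lra].
  have -> : pole (-1) = Q (0, 0) by rewrite /Q /=; congr (pole _); lra.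
  by rewrite EQ ?H0 //; [congr (g (pole _)); rewrite /=; lra|
      split => //=; rewrite in_itv /=; lra].
Qed.

(** Through [wrap], [g] becomes a cube based at the image of the pole; its contraction, read along
    radii, extends [g] over the disc. *)
Lemma extend_discS i (g : 'rV[R]_i.+2 -> X) :
  (forall x0, A x0 -> trivial_homotopy_group R A i.+1 x0) ->
  {within @sphere i.+2, continuous g} ->
  (forall w, sphere w -> A (g w)) ->
  exists E : 'rV[R]_i.+2 -> X, [/\ {within @disc i.+2, continuous E},
    forall w, disc w -> A (E w) & forall w, sphere w -> E w = g w].
Proof.
move=> trivA gc gA.
pose pole := ins ord0 1 (0 : 'rV[R]_i.+1).
have Ap : A (g pole) by apply: gA; rewrite /sphere /= norm_ins normr1 normr0 max_l.
pose q (c : 'rV[R]_i.+1) := wrap (stretch c).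
have qc : continuous q.
  by move=> c; apply: continuous_comp; [exact: continuous_stretch|exact: continuous_wrap].
have qs c : cube c -> sphere (q c) by move/stretch_cube => c3; exact: norm_wrap.
have qb c : cube_boundary c -> q c = pole.
  move=> [cc [k ck]]; have n3 : `|stretch c| = 3.
    apply/le_anti/andP; split; first exact/stretch_cube.
    apply: le_trans (le_coord_norm _ k); rewrite stretchE.
    by case: ck => ->; rewrite ?mul0rn ?sub0r ?normrN ger0_norm //; lra.
  rewrite /q /wrap n3 /height /radius subrr [Num.min 1 0]min_r // mul0r scale0r.
  by rewrite min_l ?max_r //; lra.
have based_f : based_cube A (g pole) (g \o q).
  split.
  - apply: (@within_comp _ _ _ _ (@sphere i.+2)) gc _; first exact: continuous_subspaceT.
    by move=> _ [c cc <-]; exact: qs.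
  - by move=> _ [c cc <-]; apply: gA; exact: qs.
  - by move=> c /qb /= ->.
have based_p : based_cube A (g pole) (fun _ : 'rV[R]_i.+1 => g pole).
  split=> //; last by move=> _ [c cc <-].
  by apply: continuous_subspaceT; exact: cst_continuous.
have [H [Hc H0 H1 Hb]] := trivA _ Ap _ _ based_f based_p.
(* Time [t] lies at radius [1 - t]: the end [t = 1], where [H] is constant, collapses to the
   centre. *)
pose Q (p : R * 'rV[R]_i.+1) := (1 - p.1) *: q p.2.
pose K : set (R * 'rV[R]_i.+1) := `[0, 1]%classic `*` @cube R i.+1.
have Qsurj (w : 'rV[R]_i.+2) : disc w -> exists2 c, cube c & Q (1 - `|w|, c) = w.
  move=> w1; have [->|w0] := eqVneq w 0.
    by exists 0; [move=> k; rewrite mxE lexx ler01|rewrite /Q /= normr0 subr0 subrr scale0r].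
  have n0 : `|w| != 0 by rewrite normr_eq0.
  have [|v v3 vw] := @wrap_surj R i (`|w|^-1 *: w).
    by rewrite normrZ normfV normr_id mulVf.
  have [c cc cv] := stretch_surj v3; exists c => //.
  by rewrite /Q /q /= cv vw scalerA opprB addrC subrK mulfV // scale1r.
have K_t w : @disc i.+2 w -> `[0, 1]%classic (1 - `|w|).
  by rewrite /disc /= in_itv /= => w1; have := normr_ge0 w; lra.
have Hbase t c : `[0, 1]%classic t -> cube_boundary c -> H (t, c) = g pole.
  by rewrite /= in_itv /= => t01 cb; have [_ _ ->] := Hb t t01.
have [|||||| E [EQ Ec]] := @quotient_extension _ _ X K Q H.
- exists (0, 0); split=> /=; first by rewrite in_itv /= lexx ler01.
  by move=> k; rewrite mxE lexx ler01.
- exact: compact_cylinder.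
- exact: norm_hausdorff.
- apply: continuous_subspaceT => p; apply: (@cvgZ _ _ _ (nbhs p)).
    by apply: (@cvgB _ _ _ (nbhs p)); [exact: cvg_cst|exact: cvg_fst].
  by apply: continuous_comp; [exact: cvg_snd|exact: qc].
- exact: Hc.
- move=> [t c] [t' c'] [/= t01 cc] [/= t01' cc']; rewrite /Q /= => e.
  have : `|(1 - t) *: q c| = `|(1 - t') *: q c'| by rewrite e.
  rewrite !normrZ (qs c cc) (qs c' cc') !mulr1.
  move: (t01) (t01'); rewrite !in_itv /= => t01b t01b'.
  rewrite !ger0_norm; [|lra|lra] => tt'; have {tt'} tt : t = t' by lra.
  rewrite -tt in e *; have [t1|t1] := eqVneq t 1.
    by rewrite t1 !H1.
  have t10 : 1 - t != 0 by rewrite subr_eq0 eq_sym.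
  (* [wrap] identifies only points of the boundary of the cube, where [H] is constantly [g pole]. *)
  have [|||/stretch_inj -> //|[c3 c3']] := @wrap_inj _ _ (stretch c) (stretch c').
  + exact/stretch_cube.
  + exact/stretch_cube.
  + exact: (scalerI t10 e).
  + by rewrite !Hbase //; exact: stretch_boundary.
exists E; split.
- apply: continuous_subspaceW Ec => w dw; have [c cc e] := Qsurj w dw.
  by exists (1 - `|w|, c) => //; split => //; exact: K_t.
- move=> w dw; have [c cc <-] := Qsurj w dw; rewrite EQ; last by split => //; exact: K_t.
  have [_ HA _] : based_cube A (g pole) (fun v => H (1 - `|w|, v)).
    by apply: Hb; have := K_t _ dw; rewrite /= in_itv.
  by apply: HA; exists c.
- move=> w w1; have dw : disc w by rewrite /disc /= (w1 : `|w| = 1).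
  have [c cc e] := Qsurj w dw; have := e; rewrite (w1 : `|w| = 1) subrr => e0.
  rewrite -{1}e0 EQ; last by split => //=; rewrite in_itv /= lexx ler01.
  by rewrite H0 //= -[in RHS]e0 /Q /= subr0 scale1r.
Qed.

Lemma extend_disc i (g : 'rV[R]_i.+1 -> X) :
  (forall x0, A x0 -> trivial_homotopy_group R A i x0) ->
  {within @sphere i.+1, continuous g} ->
  (forall w, sphere w -> A (g w)) ->
  exists E : 'rV[R]_i.+1 -> X, [/\ {within @disc i.+1, continuous E},
    forall w, disc w -> A (E w) & forall w, sphere w -> E w = g w].
Proof. by case: i g => [|i] g trivA gc gA; [exact: extend_disc0|exact: extend_discS]. Qed.

End Extension.

(** * Construction of the hemispheres in a highly connected space *)

Section ExistHemispheres.
Variables (R : realType) (X : topologicalType) (A : set X) (om : X -> X) (n : nat).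
Hypotheses (omK : involutive om) (om_cts : continuous om)
  (omA : forall x, A x -> A (om x)) (A0 : A !=set0).
Hypothesis trivA : forall i x0, (i < n)%N -> A x0 -> trivial_homotopy_group R A i x0.

Definition hemisphere i (e : 'rV[R]_i -> X) : Prop :=
  [/\ {within @disc R i, continuous e}, (forall u, disc u -> A (e u))
    & forall u, sphere u -> e (- u) = om (e u)].

Definition glue i (e : 'rV[R]_i -> X) (w : 'rV[R]_i.+1) : X :=
  if 0 <= w ord0 ord0 then e (tail w) else om (e (- tail w)).

Lemma closed_sphere i : closed (@sphere R i).
Proof.
apply: (@preimage_closed _ _ (fun w : 'rV[R]_i => `|w|) [set r | r = 1]) => [w _|].
  exact: norm_continuous.
exact: closed_eq.
Qed.

Lemma glue_opp i (e : 'rV[R]_i -> X) w : hemisphere e -> sphere w ->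
  glue e (- w) = om (glue e w).
Proof.
move=> [_ _ eodd] w1; rewrite /glue tail_opp opprK mxE.
have [w0|w0|w0] := ltrgtP 0 (w ord0 ord0).
- by rewrite oppr_ge0 (lt_geF w0).
- by rewrite oppr_ge0 ltW // omK.
- rewrite -w0 oppr0 lexx eodd //; move: w1.
  by rewrite -(ins_head_tail w) -w0 /sphere /= norm_ins normr0 max_r // tail_ins0.
Qed.

Lemma continuous_glue i (e : 'rV[R]_i -> X) : hemisphere e ->
  {within @sphere R i.+1, continuous (glue e)}.
Proof.
move=> [ec _ eodd].
pose S0 := @sphere R i.+1 `&` [set w | 0 <= w ord0 ord0].
pose S1 := @sphere R i.+1 `&` [set w | w ord0 ord0 <= 0].
have -> : @sphere R i.+1 = S0 `|` S1.
  rewrite predeqE => w; split=> [w1|[[]//|[]//]].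
  by have [w0|/ltW w0] := lerP 0 (w ord0 ord0); [left|right].
have coordc : continuous (fun w : 'rV[R]_i.+1 => w ord0 ord0) by exact: coord_continuous.
have tdisc w : @sphere R i.+1 w -> disc (tail w).
  by move=> w1; apply: le_trans (norm_tail w) _; rewrite (w1 : `|w| = 1).
have c0 : closed S0.
  apply: closedI; first exact: closed_sphere.
  by apply: (@preimage_closed _ _ (fun w : 'rV[R]_i.+1 => w ord0 ord0) [set r | 0 <= r])
    => [w _|]; [exact: coordc|exact: closed_ge].
have c1 : closed S1.
  apply: closedI; first exact: closed_sphere.
  by apply: (@preimage_closed _ _ (fun w : 'rV[R]_i.+1 => w ord0 ord0) [set r | r <= 0])
    => [w _|]; [exact: coordc|exact: closed_le].
apply: withinU_continuous => //.
  apply: (@subspace_eq_continuous _ S0 _ (e \o @tail R i)).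
    by move=> w; rewrite inE => -[_ /= w0]; rewrite /from_subspace /glue /= w0.
  apply: (@within_comp _ _ _ _ (@disc R i)) ec _; first exact/continuous_subspaceT/continuous_tail.
  by move=> _ [w [w1 _] <-]; exact: tdisc.
apply: (@subspace_eq_continuous _ S1 _ (om \o (e \o (fun w => - @tail R i w)))).
  move=> w; rewrite inE => -[w1 /= w0]; rewrite /from_subspace /glue /=; case: ifP => // w0'.
  have {w0 w0'} w0 : w ord0 ord0 = 0 by apply/le_anti; rewrite w0 w0'.
  rewrite eodd ?omK // /sphere /=; have : `|w| = 1 by [].
  by rewrite -{1}(ins_head_tail w) w0 norm_ins normr0 max_r.
apply: (@within_comp _ _ _ _ setT) => //; last first.
  by apply: continuous_subspaceT; exact: om_cts.
apply: (@within_comp _ _ _ _ (@disc R i)) ec _; last first.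
  by move=> _ [w [w1 _] <-]; rewrite /disc /= normrN; exact: tdisc.
apply: continuous_subspaceT => w; apply: (@cvgN _ _ _ (nbhs w)).
exact: continuous_tail.
Qed.

Lemma glue_in i (e : 'rV[R]_i -> X) w : hemisphere e -> sphere w -> A (glue e w).
Proof.
move=> [_ eA _] w1.
have tw : disc (tail w) by apply: le_trans (norm_tail w) _; rewrite (w1 : `|w| = 1).
rewrite /glue; case: ifP => _; first exact: eA.
by apply/omA/eA; rewrite /disc /= normrN.
Qed.

(** [E 0] is a point of [A]; [E i.+1] extends [glue (E i)], an equivariant map of the [i]-sphere,
    over the disc, since pi_i is trivial for [i < n]. *)
Lemma exists_hemispheres : exists E : forall i, 'rV[R]_i -> X,
  hemispheres om n E /\ forall i, (i <= n)%N -> hemisphere (@E i).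
Proof.
have [x0 Ax0] := A0.
pose next i (e : 'rV[R]_i -> X) (e' : 'rV[R]_i.+1 -> X) :=
  hemisphere e' /\ forall w, sphere w -> e' w = glue e w.
have step i (e : 'rV[R]_i -> X) : (i < n)%N -> hemisphere e -> exists e', next i e e'.
  move=> lin he.
  have [E' [Ec EA Eg]] := extend_disc (fun x Ax => trivA lin Ax) (continuous_glue he)
    (fun w => glue_in he).
  exists E'; split=> //; split=> // u u1.
  by rewrite !Eg ?glue_opp // /sphere /= normrN.
(* The constant default makes the recursion total; by [step] it is not reached for [i < n]. *)
pose ext i e := if pselect (exists e', next i e e') is left h then projT1 (cid h) else fun=> x0.
pose E := fix E i : 'rV[R]_i -> X :=
  if i is i'.+1 then ext i' (E i') else fun=> x0.
have EP i : (i < n)%N -> hemisphere (E i) -> next i (E i) (E i.+1).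
  move=> lin he /=; rewrite /ext; case: pselect => [h|]; first by case: cid.
  by move=> nh; case: nh; exact: step.
have EH i : (i <= n)%N -> hemisphere (E i).
  elim: i => [_|i IHi lin]; last by case: (EP i lin (IHi (ltnW lin))).
  split=> // [|u]; first by apply: continuous_subspaceT; exact: cst_continuous.
  by rewrite /sphere /= [u]thinmx0 normr0 => /esym/eqP; rewrite oner_eq0.
exists E; split=> // i b u lin bu1.
have [_ ->] := EP i lin (EH i (ltnW lin)); last by [].
by rewrite /glue ins0_head tail_ins0.
Qed.

End ExistHemispheres.

(** * Sign bits and fine grids *)

Section SignBits.
Variable R : realType.
Implicit Types w : nat -> R.

(* Signs are encoded by bits; a coordinate that vanishes gets the sign of the
   first nonzero one, so that opposite vectors have complementary bits. *)
Definition lead m w : R := head 0 [seq x <- [seq w l | l <- iota 0 m.+1] | x != 0].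
Definition bit m w j : int := if w j == 0 then (0 < lead m w)%R else (0 < w j)%R.

Lemma bit_opp m w j : (exists2 l, (l <= m)%N & w l != 0) ->
  bit m (fun l => - w l) j = 1 - bit m w j.
Proof.
move=> [l lm wl].
have leadN : lead m (fun l => - w l) = - lead m w.
  rewrite /lead; elim: (iota 0 m.+1) => [|a s IHs] /=; first by rewrite oppr0.
  by rewrite oppr_eq0; case: ifP.
have lead0 : lead m w != 0.
  rewrite /lead; have : w l \in [seq x <- [seq w l | l <- iota 0 m.+1] | x != 0].
    by rewrite mem_filter wl map_f // mem_iota add0n ltnS.
  case E : [seq x <- _ | _] => [//|a s] _ /=.
  have : a \in a :: s by rewrite mem_head.
  by rewrite -E mem_filter => /andP[].
have sgn (x : R) : x != 0 -> (0 < - x)%R = ~~ (0 < x)%R.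
  by move=> x0; rewrite oppr_gt0 -leNgt le_eqVlt (negPf x0).
rewrite /bit oppr_eq0 leadN; case: eqP => [_|/eqP wj]; first by rewrite sgn //; case: ltP.
by rewrite sgn //; case: ltP.
Qed.

Lemma compact_disc i : compact (@disc R i).
Proof.
have := @rV_compact R i (fun=> `[-1, 1]%classic) (fun=> @segment_compact _ _ _).
congr compact; rewrite predeqE => v; split => [h|/norm_rV_leP h k].
  by apply/norm_rV_leP => // k; have := h k; rewrite /= in_itv ler_norml.
by have := h ler01 k; rewrite /= in_itv /= ler_norml.
Qed.

(** Lebesgue number argument: each point has a nonzero coordinate, whose sign persists nearby, and
    compactness makes the size uniform. *)
Lemma small_cells i m (w : 'rV[R]_i -> nat -> R) :
  (forall l, (l <= m)%N -> {within @disc R i, continuous (fun u => w u l)}) ->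
  (forall u, disc u -> exists2 l, (l <= m)%N & w u l != 0) ->
  \forall N \near \oo, forall u, disc u -> exists2 l, (l <= m)%N &
    exists b : bool, forall v, disc v -> `|u - v| <= N.+1%:R^-1 ->
      0 < (-1) ^+ b * w v l.
Proof.
move=> wc w0.
have /near_covering_withinP cov : near_covering (@disc R i).
  by apply/compact_near_coveringP; exact: compact_disc.
pose P N u := exists2 l, (l <= m)%N &
    exists b : bool, forall v, disc v -> `|u - v| <= N.+1%:R^-1 ->
      0 < (-1) ^+ b * w v l.
apply: (cov nat \oo P) => u du; have [l lm wl] := w0 u du.
pose b := w u l < 0.
have ub : 0 < (-1) ^+ b * w u l.
  rewrite /b; have [h|h] := ltrP (w u l) 0; first by rewrite expr1 mulN1r oppr_gt0.
  by rewrite expr0 mul1r lt_neqAle eq_sym wl.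
have : \forall v \near within (@disc R i) (nbhs u), 0 < (-1) ^+ b * w v l.
  have /subspace_continuousP/(_ u du) wcu := wc l lm.
  have : (-1) ^+ b * w v l @[v --> within (@disc R i) (nbhs u)] --> (-1) ^+ b * w u l.
    by apply: cvgM; [exact: cvg_cst|exact: wcu].
  by move/cvgr_gt; apply.
rewrite near_withinE => /nbhs_ballP[e /= e0 eu].
have e20 : 0 < e / 2 by rewrite divr_gt0.
near=> x' N => _; exists l => //; exists b => v dv xv.
apply: eu => //; rewrite -ball_normE /=.
have xu : `|u - x'| < e / 2.
  have : ball u (e / 2) x' by near: x'; exact: nbhsx_ballx.
  by rewrite -ball_normE.
have Ne : N.+1%:R^-1 < e / 2 by near: N; exact: (near_infty_natSinv_lt (PosNum e20)).
have -> : u - v = (u - x') + (x' - v) by rewrite addrA subrK.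
by apply: le_lt_trans (ler_normD _ _) _; rewrite [ltRHS]splitr ltrD // (le_lt_trans xv).
Unshelve. all: by end_near. Qed.

Lemma norm_nodesB N i (c : {ffun 'I_i -> bool * 'I_N}) B B' :
  `|nodes R c B - nodes R c B'| <= N%:R^-1.
Proof.
apply/norm_rV_leP => [|k]; first by rewrite invr_ge0.
rewrite !mxE /node -!mulrA -mulrBr normrM normr_sign mul1r -mulrBl normrM normfV.
rewrite (ger0_norm (ler0n _ _)) ler_piMl ?invr_ge0 //.
by rewrite ler_norml !natrD; case: (B k); case: (B' k); rewrite /=; lra.
Qed.

Lemma grid_theta_near0 m (w : 'rV[R]_m.+1 -> nat -> R) :
  (forall l, (l <= m)%N -> {within @disc R m.+1, continuous (fun u => w u l)}) ->
  (forall u, disc u -> exists2 l, (l <= m)%N & w u l != 0) ->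
  \forall N \near \oo, grid_sum N.+1 (@theta m.+1) (fun u => bit m (w u)) = 0.
Proof.
move=> wc w0; have := small_cells wc w0; apply: filterS => N small.
apply: grid_theta_small => c.
have [|l lm [b wb]] := small (nodes R c [ffun=> false]); first exact: norm_nodes.
exists l => // B B'.
have bitE B0 : bit m (w (nodes R c B0)) l = (nat_of_bool (~~ b))%:Z.
  have := wb (nodes R c B0) (norm_nodes R c B0 (ltn0Sn N)) (norm_nodesB _ _ _).
  rewrite /bit; case: b {wb} => /=; rewrite ?expr0 ?expr1 ?mul1r ?mulN1r ?oppr_gt0 => h.
    by rewrite lt_eqF // ltNge ltW.
  by rewrite gt_eqF // h.
by rewrite !bitE.
Qed.

End SignBits.

(** Vandermonde argument: the polynomial [q] that vanishes on the rest of the support has degree at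
    most [r], so pairing it with [la] isolates [la j0]. *)
Lemma sparse_moments (R : realType) m r (la : 'I_m -> R) :
  (forall e, (e <= r)%N -> \sum_j la j * j%:R ^+ e = 0) ->
  (#|[pred j | la j != 0%R]| <= r.+1)%N -> forall j, la j = 0.
Proof.
move=> mom supp j0; apply/eqP/negPn/negP => la0.
pose rs : seq R := [seq j%:R | j : 'I_m in [predD1 [pred j | la j != 0%R] & j0]].
pose q : {poly R} := \prod_(a <- rs) ('X - a%:P).
have sq : (size q <= r.+1)%N.
  by move: supp; rewrite (cardD1 j0) inE la0 add1n /q size_prod_XsubC size_map -cardE.
have : \sum_j la j * q.[j%:R] = 0.
  under eq_bigr => j _ do rewrite horner_coef mulr_sumr.
  rewrite exchange_big big1 // => e _.
  under eq_bigr => j _ do rewrite mulrCA.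
  by rewrite -mulr_sumr mom ?mulr0 // -ltnS (leq_trans _ sq).
rewrite (bigD1 j0) //= big1 ?addr0 => [|j jj0]; last first.
  have [->|laj] := eqVneq (la j) 0; first by rewrite mul0r.
  have /rootP -> : root q j%:R; last by rewrite mulr0.
  by rewrite root_prod_XsubC; apply/mapP; exists j; rewrite ?mem_enum ?inE ?jj0.
move/eqP; rewrite mulf_eq0 (negPf la0) /= -/(root q _) root_prod_XsubC.
case/mapP => j; rewrite mem_enum !inE => /andP[/eqP jj0 _] /eqP; rewrite eqr_nat => /eqP j0j.
by apply: jj0; apply/val_inj.
Qed.

(** * The moment map on the graph complex *)

Lemma continuous_ptws (S : topologicalType) (I : Type) (K : topologicalType)
    (f : S -> {ptws I -> K}) :
  (forall i, continuous (fun s => f s i)) -> continuous f.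
Proof.
move=> fc s; apply/cvg_sup => i; have := fc i s.
move=> h U [/= V [[B oB <-] Bs VU]]; apply: filterS VU _.
by apply: h; exact: open_nbhs_nbhs.
Qed.

Section Homs.
Variables (R : realType) (T G : sgraph).
Local Notation X := (hom_space R T G).
Local Notation A := (Hom_complex R T G).

Lemma continuous_coord (x : T) (a : G) : continuous (fun p : X => p x a).
Proof.
move=> p.
have c1 : continuous (fun p : X => p x).
  exact: (@proj_continuous T (fun=> {ptws G -> R} : topologicalType) x).
have c2 : continuous (fun q : {ptws G -> R} => q a).
  exact: (@proj_continuous G (fun=> R : topologicalType) a).
exact: (@continuous_comp _ _ _ (fun p : X => p x)
  (fun q : {ptws G -> R} => q a) p (c1 p) (c2 (p x))).
Qed.

Section Action.
Variable omega : T -> T.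
Hypotheses (omegaK : involutive omega)
  (omega_edge : forall x y, edge x y -> edge (omega x) (omega y)).

Definition act (p : X) : X := fun x => p (omega x).

Lemma actK : involutive act.
Proof. by move=> p; apply/funext => x; rewrite /act omegaK. Qed.

Lemma continuous_act : continuous act.
Proof.
apply: continuous_ptws => x.
exact: (@proj_continuous T (fun=> {ptws G -> R} : topologicalType) (omega x)).
Qed.

Lemma act_Hom p : A p -> A (act p).
Proof.
move=> [eta [eta0 etaE] pe]; exists (eta \o omega); last by move=> x; exact: pe.
by split=> [x|x y /omega_edge]; [exact: eta0|exact: etaE].
Qed.

End Action.

Variables (n d : nat) (col : G -> 'I_(n + d + 1)).
Hypothesis col_edge : forall a b, edge a b -> col a != col b.

Definition weight (x y x' y' : T) (t : R) (p : X) (a : G) : R :=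
  (1 - t) / 2 * (p x a - p y a) + (1 + t) / 2 * (p x' a - p y' a).

(* The colours are placed on the moment curve of R^(n+1); moments is the
   difference of the barycentres of the colours given by the points p x and
   p y, moving linearly from (x, y) to (x', y') as t goes from -1 to 1. *)
Definition moments x y x' y' t p (l : nat) : R :=
  \sum_a weight x y x' y' t p a * (col a)%:R ^+ l.+1.

Definition signs x y p : nat -> int := bit n (moments x y x y 1 p).

Lemma moments_start x y x' y' p : moments x y x' y' (-1) p = moments x y x y 1 p.
Proof.
apply/funext => l; apply: eq_bigr => a _; congr (_ * _); rewrite /weight; lra.
Qed.

Lemma moments_end x y x' y' p : moments x y x' y' 1 p = moments x' y' x' y' 1 p.
Proof.
apply/funext => l; apply: eq_bigr => a _; congr (_ * _); rewrite /weight; lra.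
Qed.

Lemma moments_opp x y p : moments y x y x 1 p = (fun l => - moments x y x y 1 p l).
Proof.
apply/funext => l; rewrite -sumrN; apply: eq_bigr => a _.
by rewrite -mulNr; congr (_ * _); rewrite /weight; lra.
Qed.

(* The rest of a simplex uses d - 1 further colours, so that at most n + 2
   points of the moment curve matter, and these are affinely independent. *)
Lemma moments_neq0 (x y x' y' : T) (S : {set T}) t p : A p -> -1 <= t <= 1 ->
  (forall u v, u \in [:: x; x'] -> v \in [:: y; y'] -> edge u v) ->
  (forall u z, u \in [:: x; x'; y; y'] -> z \in S -> edge z u) ->
  {in S &, forall z z', z != z' -> edge z z'} -> (d <= #|S|.+1)%N ->
  exists2 l, (l <= n)%N & moments x y x' y' t p l != 0.
Proof.
move=> [eta [eta0 etaE] pe] t01 exy eS eSS dS; apply: contrapT => nmom.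
have mom0 l : (l <= n)%N -> moments x y x' y' t p l = 0.
  by move=> ln; apply/eqP/negPn/negP => h; apply: nmom; exists l.
have p_supp z a : p z a != 0 -> a \in eta z.
  have [_ _ h] := pe z; apply: contraNT => /h ->; exact: eqxx.
have p_ge0 z a : 0 <= p z a by have [h _ _] := pe z.
have p_sum z : \sum_a p z a = 1 by have [_ h _] := pe z.
have sep z z' a a' : edge z z' -> p z a != 0 -> p z' a' != 0 -> col a != col a'.
  by move=> zz' /p_supp az /p_supp az'; apply: col_edge; exact: (etaE _ _ zz').
(* The total weight of colour [j]: a signed measure on the points of the curve. *)
pose la j := \sum_(a | col a == j) weight x y x' y' t p a.
have momE e : \sum_j la j * j%:R ^+ e = \sum_a weight x y x' y' t p a * (col a)%:R ^+ e.
  rewrite (partition_big col xpredT) //=; apply: eq_bigr => j _.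
  by rewrite mulr_suml; apply: eq_bigr => a /eqP ->.
pose wX a := (1 - t) / 2 * p x a + (1 + t) / 2 * p x' a.
have wX_ge0 a : 0 <= wX a by rewrite addr_ge0 // mulr_ge0 //; lra.
have wX_supp a : wX a != 0 -> exists2 u, u \in [:: x; x'] & p u a != 0.
  move=> w0; have [px|px] := eqVneq (p x a) 0; last by exists x; rewrite // inE eqxx.
  exists x'; first by rewrite !inE eqxx orbT.
  by apply: contraNneq w0 => px'; rewrite /wX px px' !mulr0 addr0.
pose wY a := (1 - t) / 2 * p y a + (1 + t) / 2 * p y' a.
have wY_supp a : wY a != 0 -> exists2 u, u \in [:: y; y'] & p u a != 0.
  move=> w0; have [py|py] := eqVneq (p y a) 0; last by exists y; rewrite // inE eqxx.
  exists y'; first by rewrite !inE eqxx orbT.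
  by apply: contraNneq w0 => py'; rewrite /wY py py' !mulr0 addr0.
have weightE a : weight x y x' y' t p a = wX a - wY a by rewrite /weight /wX /wY; ring.
have wX_sum : \sum_a wX a = 1.
  by rewrite big_split /= -!mulr_sumr !p_sum; lra.
have wY_sum : \sum_a wY a = 1.
  by rewrite big_split /= -!mulr_sumr !p_sum; lra.
have pt z : exists a, p z a != 0.
  apply/existsP; apply: contraPT (p_sum z) => /existsPn h.
  rewrite big1 => [/esym/eqP|a _]; first by rewrite oner_eq0.
  by apply/eqP/negPn/h.
pose f z := projT1 (cid (pt z)).
have fP z : p z (f z) != 0 by rewrite /f; case: cid.
(* [z] is adjacent to [x], [x'], [y] and [y'], so its colour differs from all of theirs and carries
   no weight. *)
have la_rest z : z \in S -> la (col (f z)) = 0.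
  move=> zS; apply: big1 => a /eqP az; rewrite weightE.
  have [wX0|/wX_supp[u ux ua]] := eqVneq (wX a) 0; last first.
    have uz : edge z u by apply: eS => //; move: ux; rewrite !inE => /orP[] ->; rewrite ?orbT.
    by have := sep _ _ _ _ uz (fP z) ua; rewrite az eqxx.
  have [wY0|/wY_supp[u ux ua]] := eqVneq (wY a) 0; last first.
    have uz : edge z u by apply: eS => //; move: ux; rewrite !inE => /orP[] ->; rewrite ?orbT.
    by have := sep _ _ _ _ uz (fP z) ua; rewrite az eqxx.
  by rewrite wX0 wY0 subrr.
(* Exponent 0 vanishes because both barycentres have mass 1. [S] rules out at least [d - 1] of the
   [n + d + 1] colours, leaving at most [n + 2]. *)
have la0 : forall j, la j = 0.
  apply: (@sparse_moments _ _ n.+1) => [[_|e en]|]; rewrite ?momE.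
  - under eq_bigr do rewrite weightE mulr1.
    by rewrite sumrB wX_sum wY_sum subrr.
  - exact: mom0.
  have inj : {in S &, injective (fun z => col (f z))}.
    move=> z z' zS z'S czz'; apply/eqP/negPn/negP => zz'.
    by have := sep _ _ _ _ (eSS _ _ zS z'S zz') (fP z) (fP z'); rewrite czz' eqxx.
  pose Q := finset.imset (fun z => col (f z)) (mem S).
  have cQ : #|Q| = #|S| by exact: card_in_imset.
  have subQ : [pred j | la j != 0%R] \subset finset.setC Q.
    apply/fintype.subsetP => j; rewrite !inE => laj; apply/imsetP => -[z zS jz].
    by move: laj; rewrite jz la_rest ?eqxx.
  apply: leq_trans (subset_leq_card subQ) _.
  by rewrite -(leq_add2l #|Q|) cardsC card_ord cQ; lia.
(* The colours of [wX] and [wY] are disjoint, so [la] would be positive at a colour of [wX]. *)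
have [a0 wa0] : exists a, wX a != 0.
  apply/existsP; apply: contraPT wX_sum => /existsPn h.
  rewrite big1 => [/esym/eqP|a _]; first by rewrite oner_eq0.
  by apply/eqP/negPn/h.
have := la0 (col a0); rewrite /la.
have -> : \sum_(a | col a == col a0) weight x y x' y' t p a = \sum_(a | col a == col a0) wX a.
  apply: eq_bigr => a /eqP aa0; rewrite weightE.
  have [->|/wY_supp[v vy va]] := eqVneq (wY a) 0; first by rewrite subr0.
  have [u ux ua] := wX_supp _ wa0.
  by have := sep _ _ _ _ (exy _ _ ux vy) ua va; rewrite aa0 eqxx.
by move/psumr_eq0P => /(_ (fun a _ => wX_ge0 a)) /(_ a0 (eqxx _)) /eqP; rewrite (negPf wa0).
Qed.

End Homs.

(** * The degree of a pair of vertices *)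

Section Degree.
Variables (R : realType) (d : nat) (W : scomplex) (omega : W -> W) (G : sgraph).
Hypothesis hPhi : Phi_complex d W omega.
Local Notation T := (skeleton1 W).
Local Notation X := (hom_space R T G).
Local Notation A := (Hom_complex R T G).
Local Notation aom := (@act R T G omega).

Lemma omega_edge (x y : T) : edge x y -> edge (omega x : T) (omega y).
Proof.
move=> /andP[xy xyW]; apply/andP; split.
  by rewrite (inj_eq (inv_inj (Phi_involutive hPhi))).
by have := Phi_simplicial hPhi xyW; rewrite imsetU1 imset_set1.
Qed.

Lemma dsimplex_edge (s : {set W}) (x y : T) : s \in dsimplices W d ->
  x \in s -> y \in s -> x != y -> edge x y.
Proof.
rewrite inE => /andP[sW _] xs ys xy; apply/andP; split => //.
by apply: (simplicesS _ sW); apply/fintype.subsetP => z; rewrite !inE => /orP[] /eqP ->.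
Qed.

(** Only one vertex of [s] lies off the common face [e], so [g] fixes [x] or [y]: the edge is found
    in [t] or in [s]. *)
Lemma perspectivity_edge (s t : {set W}) g (x y : T) :
  s \in dsimplices W d -> t \in dsimplices W d -> perspectivity d s t g ->
  x \in s -> y \in s -> x != y -> edge x (g y : T).
Proof.
move=> sW tW [e [ce es et] [ginj gst ge]] xs ys xy.
have gs z : z \in s -> g z \in t by move=> zs; rewrite -gst imset_f.
have [ye|ye] := boolP (y \in e); first by rewrite ge //; exact: (dsimplex_edge sW).
have xe : x \in e.
  have : #|s :\: e| = 1%N.
    move: sW; rewrite inE => /andP[_ /eqP cs].
    by rewrite cardsD (finset.setIidPr es) cs ce subSnn.
  move/eqP/cards1P => [z sz]; apply: contraNT xy => xe.
  have : x \in s :\: e by rewrite inE xe.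
  have : y \in s :\: e by rewrite inE ye.
  by rewrite sz !inE => /eqP -> /eqP ->.
rewrite -(ge x xe); apply: (dsimplex_edge tW); rewrite ?gs //.
by apply: contraNneq xy => /ginj ->.
Qed.

Variables (n : nat) (col : G -> 'I_(n + d + 1)).
Hypothesis col_edge : forall a b, edge a b -> col a != col b.
Hypothesis n_even : ~~ odd n.
Variable E : forall i, 'rV[R]_i -> X.
Hypothesis hE : hemispheres aom n E.
Hypothesis hcE : forall i, (i <= n)%N -> hemisphere A aom (@E i).

Local Notation actK := (@actK R T G omega (Phi_involutive hPhi)).

Lemma continuous_moments (x y x' y' : T) (l : nat) (f : X -> X) : continuous f ->
  {within @disc R n.+1, continuous
    (fun u => moments col x y x' y' (u ord0 ord0) (f (E (tail u))) l)}.
Proof.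
move=> fc; have [Ec _ _] := hcE (leqnn n).
have Etc : {within @disc R n.+1, continuous ((f \o @E n) \o @tail R n)}.
  apply: (@within_comp _ _ _ _ (@disc R n)).
  - exact/continuous_subspaceT/continuous_tail.
  - apply: (@within_comp _ _ _ _ setT) => //; first exact: continuous_subspaceT.
  - by move=> _ [u u1 <-]; apply: le_trans (norm_tail u) _.
apply/subspace_continuousP => u du.
have pc z a : f (E (tail v)) z a @[v --> within (@disc R n.+1) (nbhs u)] --> f (E (tail u)) z a.
  have /subspace_continuousP h : {within @disc R n.+1, continuous
      ((fun p : X => p z a) \o ((f \o @E n) \o @tail R n))}.
    apply: (@within_comp _ _ _ _ setT) => //.
    by apply: continuous_subspaceT; exact: continuous_coord.
  exact: h.
have tc : v ord0 ord0 @[v --> within (@disc R n.+1) (nbhs u)] --> u ord0 ord0.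
  have /subspace_continuousP h : {within @disc R n.+1, continuous (fun v => v ord0 ord0)}.
    by apply: continuous_subspaceT; exact: coord_continuous.
  exact: h.
rewrite /moments; apply: cvg_big => [|a _]; first exact: add_continuous.
apply: cvgM; last exact: cvg_cst.
apply: cvgD; apply: cvgM.
- by apply: cvgM; [apply: cvgB; [exact: cvg_cst|exact: tc]|exact: cvg_cst].
- by apply: cvgB; exact: pc.
- by apply: cvgM; [apply: cvgD; [exact: cvg_cst|exact: tc]|exact: cvg_cst].
- by apply: cvgB; exact: pc.
Qed.

(* The degree on the grid of the map from the n-sphere to R^(n+1) minus 0; the
   second term is the contribution of the lower hemisphere. *)
Definition degree N (x y : T) : int :=
  grid_sum N.+1 (@kappa n) (fun u => signs col x y (@E n u))
  - grid_sum N.+1 (@kappa n) (fun u => signs col x y (aom (@E n u))).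

(** The action exchanges the two terms of [degree]; their opposite signs reflect that the antipodal
    map has degree -1 for even [n]. *)
Lemma degree_antipode N (x y : T) :
  degree N (omega x : T) (omega y : T) = - degree N x y.
Proof.
rewrite /degree opprB; congr (_ - grid_sum _ _ _); apply/funext => u.
by rewrite -[in RHS](actK (E u)).
Qed.

(** The linear homotopy never vanishes, by [moments_neq0] with the remaining vertices [S] of [s];
    these are adjacent to [g x] and [g y] by [perspectivity_edge]. On fine grids
    [grid_kappa_transport] then applies. *)
Lemma degree_perspectivity (s t : {set W}) g (x y : T) :
  s \in dsimplices W d -> t \in dsimplices W d -> perspectivity d s t g ->
  x \in s -> y \in s -> x != y ->
  \forall N \near \oo, degree N x y = degree N (g x : T) (g y : T).
Proof.
move=> sW tW sgt xs ys xy.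
pose S := s :\: [set x; y]%SET.
have cS : (d <= #|S|.+1)%N.
  have xys : [set x; y]%SET \subset s.
    by apply/fintype.subsetP => z; rewrite !inE => /orP[] /eqP ->.
  rewrite cardsD (finset.setIidPr xys) cards2 xy; move: sW; rewrite inE => /andP[_ /eqP ->].
  by rewrite subSS; lia.
have gs z : z \in s -> g z \in t by case: sgt => e _ [_ <- _] zs; rewrite imset_f.
have ginj : {in s &, injective g} by case: sgt => e _ [].
have gxy : g x != g y by apply: contraNneq xy => /ginj ->.
have edgeC (u v : T) : edge u v = edge v u by rewrite edge_sym.
have exy (u v : T) : u \in [:: x; g x] -> v \in [:: y; g y] -> edge u v.
  rewrite !inE => /orP[] /eqP -> /orP[] /eqP ->.
  - exact: (dsimplex_edge sW).
  - exact: (perspectivity_edge sW tW sgt).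
  - by rewrite edgeC; apply: (perspectivity_edge sW tW sgt); rewrite // eq_sym.
  - by apply: (dsimplex_edge tW); rewrite ?gs.
have eS (u z : T) : u \in [:: x; g x; y; g y] -> z \in S -> edge z u.
  rewrite !inE => ux /andP[/norP[zx zy] zs]; move: ux => /or4P[] /eqP ->.
  - exact: (dsimplex_edge sW).
  - exact: (perspectivity_edge sW tW sgt).
  - exact: (dsimplex_edge sW).
  - exact: (perspectivity_edge sW tW sgt).
have eSS : {in S &, forall z z' : T, z != z' -> edge z z'}.
  by move=> z z'; rewrite !inE => /andP[_ zs] /andP[_ zs'] zz'; exact: (dsimplex_edge sW).
have neq0 f (u : 'rV[R]_n.+1) : (forall p, A p -> A (f p)) -> disc u -> exists2 l, (l <= n)%N &
    moments col x y (g x) (g y) (u ord0 ord0) (f (E (tail u))) l != 0.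
  move=> fA du; have [_ EA _] := hcE (leqnn n).
  apply: (@moments_neq0 R T G n d col col_edge x y (g x) (g y) S) => //.
    by apply/fA/EA; apply: le_trans (norm_tail u) _.
  by rewrite -ler_norml; apply: le_trans (le_coord_norm u ord0) _.
have near0 f : continuous f -> (forall p, A p -> A (f p)) -> \forall N \near \oo,
    grid_sum N.+1 (@theta n.+1) (@track R X E n
      (fun t p => bit n (moments col x y (g x) (g y) t (f p)))) = 0.
  move=> fc fA; apply: grid_theta_near0 => [l _|u du]; first exact: continuous_moments.
  exact: neq0.
have act_A p : A p -> A (aom p) by apply: act_Hom; exact: omega_edge.
have idc : continuous (@id X) by move=> p; exact: cvg_id.
have n1 := near0 id idc (fun p Ap => Ap).
have n2 := near0 aom (@continuous_act R T G omega) act_A.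
near=> N.
have := grid_kappa_transport actK hE (ltn0Sn N)
  (H := fun t p => bit n (moments col x y (g x) (g y) t p)) n_even.
have t1 : grid_sum N.+1 (@theta n.+1) (@track R X E n
    (fun t p => bit n (moments col x y (g x) (g y) t p))) = 0 by near: N.
have t2 : grid_sum N.+1 (@theta n.+1) (@track R X E n
    (fun t p => bit n (moments col x y (g x) (g y) t (aom p)))) = 0 by near: N.
have at_end (f : 'rV[R]_n -> X) : grid_sum N.+1 (@kappa n) (fun u =>
    bit n (moments col x y (g x) (g y) 1 (f u))) =
    grid_sum N.+1 (@kappa n) (fun u => signs col (g x : T) (g y : T) (f u)).
  by congr grid_sum; apply/funext => u; rewrite moments_end.
have at_start (f : 'rV[R]_n -> X) : grid_sum N.+1 (@kappa n) (fun u =>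
    bit n (moments col x y (g x) (g y) (-1) (f u))) =
    grid_sum N.+1 (@kappa n) (fun u => signs col x y (f u)).
  by congr grid_sum; apply/funext => u; rewrite moments_start.
by move=> /(_ t1 t2); rewrite !at_end !at_start => h; exact: esym h.
Unshelve. all: by end_near. Qed.

Lemma degree_projectivity (s t : {set W}) g : projectivity d s t g ->
  [/\ t \in dsimplices W d, {in s, forall x, g x \in t}, {in s &, injective g}
    & {in s &, forall x y : T, x != y ->
        \forall N \near \oo, degree N x y = degree N (g x : T) (g y : T)}].
Proof.
elim=> [sW|t' u f h pst [tW fs finj IH] uW tuh].
  by split=> // x y xs ys xy; near=> N.
have [hs hinj] : {in t', forall x, h x \in u} /\ {in t' &, injective h}.
  by case: tuh => e _ [hinj <- _]; split=> // x xt; rewrite imset_f.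
split=> //= [x xs|x y xs ys /hinj/finj|x y xs ys xy].
- by apply/hs/fs.
- by apply=> //; apply: fs.
- have fxy : f x != f y by apply: contraNneq xy => /finj ->.
  have := degree_perspectivity tW uW tuh (fs x xs) (fs y ys) fxy.
  by apply: filter_app; have := IH x y xs ys xy; apply: filterS => N -> ->.
Unshelve. all: by end_near. Qed.

(** The action swaps [x] and [y], which negates the moments and complements the bits; the degree is
    thus twice a [kappa] sum minus the odd [theta] sum. *)
Lemma odd_degree N (s : {set W}) (x y : T) : s \in dsimplices W d ->
  x \in s -> y \in s -> x != y -> omega x = y ->
  exists z, degree N x y = 2 * z + 1.
Proof.
move=> sW xs ys xy xy'.
have yx' : omega y = x by rewrite -xy' (Phi_involutive hPhi).
pose S := s :\: [set x; y]%SET.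
have cS : (d <= #|S|.+1)%N.
  have xys : [set x; y]%SET \subset s.
    by apply/fintype.subsetP => z; rewrite !inE => /orP[] /eqP ->.
  rewrite cardsD (finset.setIidPr xys) cards2 xy; move: sW; rewrite inE => /andP[_ /eqP ->].
  by rewrite subSS; lia.
have neq0 p : A p -> exists2 l, (l <= n)%N & moments col x y x y 1 p l != 0.
  move=> Ap; apply: (@moments_neq0 R T G n d col col_edge x y x y S) => //.
  - by apply/andP; split; lra.
  - move=> u v; rewrite !inE !orbb => /eqP -> /eqP ->; exact: (dsimplex_edge sW).
  - move=> u z; rewrite !inE => ux /andP[/norP[zx zy] zs]; move: ux.
    by move=> /or4P[] /eqP ->; apply: (dsimplex_edge sW).
  - by move=> z z'; rewrite !inE => /andP[_ zs] /andP[_ zs'] zz'; exact: (dsimplex_edge sW).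
have signs_act p j : A p -> signs col x y (aom p) j = 1 - signs col x y p j.
  move=> Ap; rewrite -(bit_opp j (neq0 p Ap)) -moments_opp /signs.
  congr bit; apply/funext => l; apply: eq_bigr => a _.
  by rewrite /weight /act xy' yx'.
have EA i (u : 'rV[R]_i) : (i <= n)%N -> `|u| <= 1 -> A (E u).
  by move=> lin u1; have [_ EA _] := hcE lin; exact: EA.
have [|z Az] := @odd_grid_theta R X aom n actK E hE N.+1 (ltn0Sn N) (signs col x y) _ n (leqnn n).
  by move=> i u j lin u1; rewrite signs_act //; exact: EA.
rewrite /degree [X in _ - X](@eq_grid_sum _ _ _ _ _ _ (fun u j => 1 - signs col x y (@E n u) j)) //.
  rewrite grid_kappa_compl Az -signr_odd (negPf n_even) expr0 mul1r.
  set b := grid_sum _ _ _; exists (b - z - 1); ring.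
by move=> u u1; apply/funext => j; rewrite signs_act //; exact: EA.
Qed.

Lemma no_hemispheres : False.
Proof.
have [s [sW sfix [g pg gomega] nid]] := Phi_projectivity hPhi.
have [x xs xfix] : exists2 x, x \in s & omega x != x.
  apply: contrapT => h; apply: nid => x xs; apply/eqP/negPn/negP => xfix.
  by apply: h; exists x.
have oxs : omega x \in s by rewrite -sfix imset_f.
have [_ _ _ degg] := degree_projectivity pg.
have xox : x != omega x by rewrite eq_sym.
have [N] := filter_ex (degg x (omega x) xs oxs xox).
(* As [g] agrees with [omega] on [s], the degree equals its own opposite, while it is odd. *)
rewrite -!gomega // degree_antipode.
have [z ->] := odd_degree N sW xs oxs xox (erefl _); lia.
Qed.

End Degree.

Theorem theorem4p24 (R : realType) (d : nat) (W : scomplex) (omega : W -> W)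
    (hPhi : Phi_complex d W omega) (hflag : flag W)
    (k : int) (hk : -1 <= k) (hodd : odd `|k|%N) (G : sgraph) :
  k_connected R (Hom_complex R (skeleton1 W) G) k ->
  k + d%:Z + 3 <= (chi G)%:Z.
Proof.
move=> [A0 trivA]; rewrite leNgt; apply/negP => chi_small.
(* [k + 1] is nonnegative and even, so the absolute value only turns it into a natural number. *)
pose n := `|(k + 1)%R|%N.
have nk : n%:Z = k + 1 by rewrite /n; lia.
have n_even : ~~ odd n by rewrite /n; move: hodd hk; lia.
have [col col_edge] : exists col : G -> 'I_(n + d + 1),
    forall a b, edge a b -> col a != col b.
  have chi_le : (chi G <= n + d + 1)%N by lia.
  have /existsP[c /forallP cP] : colorable G (chi G) by rewrite /chi; case: ex_minnP.
  exists (fun a => widen_ord chi_le (c a)) => a b ab.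
  by have /forallP/(_ b)/implyP/(_ ab) := cP a.
have omK := Phi_involutive hPhi.
have [|E [hE hcE]] := @exists_hemispheres R _ (Hom_complex R (skeleton1 W) G)
  (@act R (skeleton1 W) G omega) n (@actK R (skeleton1 W) G omega omK)
  (@continuous_act R (skeleton1 W) G omega)
  (@act_Hom R (skeleton1 W) G omega (omega_edge hPhi)) A0.
  by move=> i x0 lin Ax0; apply: trivA => //; lia.
exact: (no_hemispheres hPhi col_edge n_even hE hcE).
Qed.
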